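(* Let $G=N\rtimes\mathbb{Z}$, where $N$ is abelian and finitely generated as an abelian group. Regard $N$ as a $\mathbb{Z}[x]$-module, with $x$ acting as conjugation by a chosen generator of $\mathbb{Z}$. Let $$\mathbb{Q}\otimes_{\mathbb{Z}}N\cong\bigoplus_{j=1}^d\mathbb{Q}[x]/(a_j),\qquad a_1\mid a_2\mid\cdots\mid a_d,$$ be the decomposition as a $\mathbb{Q}[x]$-module provided by the structure theorem for finitely generated modules over a PID, where $a_1$ is not a unit and $d\ge 1$ (so $d=d_{\mathbb{Q}[x]}(\mathbb{Q}\otimes_{\mathbb{Z}}N)$ is the minimal number of generators of $\mathbb{Q}\otimes_{\mathbb{Z}} N$ as a $\mathbb{Q}[x]$-module). Let $\rho_1$ be the number of distinct roots of $a_1$ in $\mathbb{C}$. Then $$m_n(G)\le\rho_1n^d+O(n^{d-1})\quad\text{for all large } n,$$ and $$m_n(G)\ge\rho_1n^d\quad\text{for infinitely many } n.$$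
   Context: For a finitely generated group $G$, $m_n(G)$ denotes the number of maximal subgroups of $G$ of index $n$. *)

(* Defs.v *)
From HB Require Import structures.
From mathcomp Require Import all_boot all_order all_algebra.
From mathcomp Require Import generic_quotient ring_quotient.
From mathcomp Require Import boolp classical_sets functions cardinality.
From mathcomp Require Import reals ereal topology normedtype landau.
From mathcomp Require Import counting_measure.
From mathcomp Require Import complex.
From mathcomp Require Import zify ring.

Set Implicit Arguments.
Unset Strict Implicit.
Unset Printing Implicit Defensive.

Import Order.TTheory GRing.Theory Num.Theory.

Section Subgroups.
Local Open Scope group_scope.
Local Open Scope classical_set_scope.
Local Open Scope card_scope.
Variable G : groupType.

Definition is_subgroup (H : set G) : Prop :=
  [/\ H 1, forall x y, H x -> H y -> H (x * y) & forall x, H x -> H x^-1].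

Definition left_cosets (H : set G) : set (set G) :=
  range (fun x : G => [set x * h | h in H]).

Definition has_index (H : set G) (n : nat) : Prop := left_cosets H #= `I_n.

Definition is_maximal_subgroup (H : set G) : Prop :=
  [/\ is_subgroup H, H <> setT &
      forall K : set G, is_subgroup K -> H `<=` K -> K = H \/ K = setT].

(* m_n(G), with values in the extended reals, so that an infinite number of
   subgroups would be counted as +oo. *)
Definition nb_maximal_subgroups (R : realType) (n : nat) : \bar R :=
  counting [set H : set G | is_maximal_subgroup H /\ has_index H n].

End Subgroups.

Local Open Scope ring_scope.
Local Open Scope quotient_scope.

Definition finitely_generated_zmod (N : zmodType) : Prop :=
  exists (k : nat) (g : 'I_k -> N),
    forall v : N, exists c : 'I_k -> int, v = \sum_(i < k) g i *~ c i.

Section SemidirectProduct.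
Variables (N : zmodType) (phi : {additive N -> N}) (phi_bij : bijective phi).

Lemma bij_surj (y : N) : exists x, phi x == y.
Proof. by case: phi_bij => g _ gK; exists (g y); rewrite gK. Qed.

Definition phi_inv (y : N) : N := xchoose (bij_surj y).

Lemma phi_invK : cancel phi_inv phi.
Proof. by move=> y; apply/eqP/(xchooseP (bij_surj y)). Qed.

Lemma phiK : cancel phi phi_inv.
Proof. by move=> y; apply: (bij_inj phi_bij); rewrite phi_invK. Qed.

Definition phi_pow (m : int) (v : N) : N :=
  match m with
  | Posz k => iter k phi v
  | Negz k => iter k.+1 phi_inv v
  end.

Lemma phi_powS m v : phi_pow (m + 1) v = phi (phi_pow m v).
Proof.
case: m => [k|[|k]].
- by have -> : Posz k + 1 = Posz k.+1 by lia.
- by rewrite /= phi_invK.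
- have -> : Negz k.+1 + 1 = Negz k by lia.
  by rewrite /= phi_invK.
Qed.

Lemma phi_powD m k v : phi_pow (m + k) v = phi_pow m (phi_pow k v).
Proof.
have h (j : nat) : forall l, phi_pow (j%:Z + l) v = phi_pow j (phi_pow l v).
  elim: j => [l|j IH l]; first by rewrite add0r.
  have -> : j.+1%:Z + l = (j%:Z + l) + 1 by lia.
  by rewrite phi_powS IH.
case: m => [j|j]; first exact: h.
have inj_it : injective (iter j.+1 phi).
  elim: j.+1 => [//|i IH] x y /= /(bij_inj phi_bij); exact: IH.
have itK w : iter j.+1 phi (iter j.+1 phi_inv w) = w.
  elim: j.+1 w => [//|i IH] w; rewrite iterSr [iter i.+1 phi_inv w]iterS.
  by rewrite phi_invK IH.
apply: inj_it; rewrite [phi_pow (Negz j) _]/= itK.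
rewrite -[LHS]/(phi_pow j.+1%:Z (phi_pow (Negz j + k) v)) -h.
by congr (phi_pow _ v); lia.
Qed.

Lemma phi_pow_is_additive m : {morph phi_pow m : x y / x + y}.
Proof.
have iD k : {morph iter k phi : x y / x + y}.
  by elim: k => [//|k IH] x y /=; rewrite IH raddfD.
case: m => [k|k] x y; first exact: iD.
have invD : {morph phi_inv : x y / x + y}.
  by move=> u v; apply: (bij_inj phi_bij); rewrite raddfD !phi_invK.
by rewrite /phi_pow; elim: k.+1 => [//|i IH] /=; rewrite IH invD.
Qed.

(* N ><| Z, where the generator 1 of Z acts on N as phi, see sdprodZ_conj. *)
Definition sdprodZ (_ : bijective phi) : Type := (N * int)%type.
Local Notation G := (sdprodZ phi_bij).
HB.instance Definition _ := Choice.on G.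

Definition sdprodZ_one : G := (0, 0).
Definition sdprodZ_mul (x y : G) : G := (x.1 + phi_pow x.2 y.1, x.2 + y.2).
Definition sdprodZ_inv (x : G) : G := (- phi_pow (- x.2) x.1, - x.2).

Lemma phi_pow0 m : phi_pow m 0 = 0.
Proof. by apply: (addrI (phi_pow m 0)); rewrite -phi_pow_is_additive !addr0. Qed.

Lemma phi_powN m v : phi_pow m (- v) = - phi_pow m v.
Proof.
by apply: (addrI (phi_pow m v)); rewrite -phi_pow_is_additive !subrr phi_pow0.
Qed.

Lemma sdprodZ_mulA : associative sdprodZ_mul.
Proof.
move=> x y z; rewrite /sdprodZ_mul /=.
by rewrite phi_pow_is_additive phi_powD !addrA.
Qed.

Lemma sdprodZ_mul1 : left_id sdprodZ_one sdprodZ_mul.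
Proof. by case=> v m; rewrite /sdprodZ_mul /= !add0r. Qed.

Lemma sdprodZ_mulr1 : right_id sdprodZ_one sdprodZ_mul.
Proof. by case=> v m; rewrite /sdprodZ_mul /= phi_pow0 !addr0. Qed.

Lemma sdprodZ_mulV : left_inverse sdprodZ_one sdprodZ_inv sdprodZ_mul.
Proof. by case=> v m; rewrite /sdprodZ_mul /= !addNr. Qed.

Lemma sdprodZ_mulrV : right_inverse sdprodZ_one sdprodZ_inv sdprodZ_mul.
Proof.
by case=> v m; rewrite /sdprodZ_mul /= phi_powN -phi_powD !subrr.
Qed.

HB.instance Definition _ := isGroup.Build G sdprodZ_mulA sdprodZ_mul1
  sdprodZ_mulr1 sdprodZ_mulV sdprodZ_mulrV.

Definition sdprodZ_base (v : N) : G := (v, 0).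
Definition sdprodZ_gen : G := (0, 1).

Lemma sdprodZ_conj (v : N) :
  (sdprodZ_gen * sdprodZ_base v * sdprodZ_gen^-1)%g = sdprodZ_base (phi v).
Proof.
rewrite -[LHS]/(sdprodZ_mul (sdprodZ_mul sdprodZ_gen (sdprodZ_base v))
  (sdprodZ_inv sdprodZ_gen)) /sdprodZ_mul /sdprodZ_inv [_.1]/= [_.2]/=.
by rewrite phi_pow0 oppr0 phi_pow0 addr0 add0r.
Qed.

End SemidirectProduct.

(* The rational vector space Q \otimes_Z N, realised as the module of
   fractions of N: the pair (v, k) stands for (k + 1)^-1 \otimes v. *)

Section Rationalization.
Variable N : zmodType.
Implicit Types p q r : N * nat.

Definition frac_equiv p q : bool :=
  `[< exists u : nat, p.1 *+ (q.2.+1 * u.+1) = q.1 *+ (p.2.+1 * u.+1) >].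

Lemma frac_equiv_refl : reflexive frac_equiv.
Proof. by move=> p; apply/asboolP; exists 0%N. Qed.

Lemma frac_equiv_sym : symmetric frac_equiv.
Proof.
by move=> p q; apply/asboolP/asboolP => -[u e]; exists u.
Qed.

Lemma frac_equiv_trans : transitive frac_equiv.
Proof.
move=> q p r /asboolP[u eu] /asboolP[w ew]; apply/asboolP.
exists (q.2.+1 * u.+1 * w.+1).-1.
rewrite prednK ?muln_gt0 //.
transitivity ((p.1 *+ (q.2.+1 * u.+1)) *+ (r.2.+1 * w.+1)).
  by rewrite -mulrnA; congr (_ *+ _); lia.
rewrite eu; transitivity ((q.1 *+ (r.2.+1 * w.+1)) *+ (p.2.+1 * u.+1)).
  by rewrite -!mulrnA; congr (_ *+ _); lia.
by rewrite ew -!mulrnA; congr (_ *+ _); lia.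
Qed.

Canonical frac_equiv_rel :=
  EquivRel frac_equiv frac_equiv_refl frac_equiv_sym frac_equiv_trans.

Definition rationalization : Type := {eq_quot frac_equiv}.
HB.instance Definition _ := Choice.on rationalization.
Local Notation QN := rationalization.

Definition frac (v : N) (k : nat) : QN := \pi_({eq_quot frac_equiv}) (v, k).
Definition fnum (x : QN) : N := (repr (x : {eq_quot frac_equiv})).1.
Definition fden (x : QN) : nat := (repr (x : {eq_quot frac_equiv})).2.

Lemma fracE x : frac (fnum x) (fden x) = x.
Proof. by rewrite /frac /fnum /fden -surjective_pairing reprK. Qed.

Lemma frac_eqP v k w l :
  frac v k = frac w l <->
  exists u : nat, v *+ (l.+1 * u.+1) = w *+ (k.+1 * u.+1).
Proof.
split=> [/eqmodP/asboolP//|h].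
by apply/eqmodP/asboolP.
Qed.

Lemma frac_mulrn v k c : frac v k = frac (v *+ c.+1) (k.+1 * c.+1).-1.
Proof.
apply/frac_eqP; exists 0%N; rewrite -mulrnA; congr (_ *+ _).
by rewrite prednK ?muln_gt0 // !muln1 mulnC.
Qed.

Lemma frac2P (x y : QN) : exists v w k, x = frac v k /\ y = frac w k.
Proof.
exists (fnum x *+ (fden y).+1), (fnum y *+ (fden x).+1).
exists ((fden x).+1 * (fden y).+1).-1; split.
  by rewrite -frac_mulrn fracE.
by rewrite mulnC -frac_mulrn fracE.
Qed.

Lemma frac3P (x y z : QN) :
  exists u v w k, [/\ x = frac u k, y = frac v k & z = frac w k].
Proof.
have [u [v [k [-> ->]]]] := frac2P x y.
exists (u *+ (fden z).+1), (v *+ (fden z).+1), (fnum z *+ k.+1).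
exists (k.+1 * (fden z).+1).-1; split; try exact: frac_mulrn.
by rewrite mulnC -frac_mulrn fracE.
Qed.

Definition frac_zero : QN := frac 0 0.
Definition frac_opp (x : QN) : QN := frac (- fnum x) (fden x).
Definition frac_add (x y : QN) : QN :=
  frac (fnum x *+ (fden y).+1 + fnum y *+ (fden x).+1)
       ((fden x).+1 * (fden y).+1).-1.
Definition frac_scale (c : rat) (x : QN) : QN :=
  frac (fnum x *~ numq c) ((fden x).+1 * `|denq c|%N).-1.

Lemma frac_oppE v k : frac_opp (frac v k) = frac (- v) k.
Proof.
have /frac_eqP[u e] := fracE (frac v k).
by apply/frac_eqP; exists u; rewrite !mulNrn e.
Qed.

Lemma frac_addE v w k : frac_add (frac v k) (frac w k) = frac (v + w) k.
Proof.
rewrite /frac_add.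
have /frac_eqP[a ea] := fracE (frac v k).
have /frac_eqP[b eb] := fracE (frac w k).
move: (fnum _) (fden _) (fnum _) (fden _) ea eb => w' l v' m ea eb.
apply/frac_eqP; exists (a.+1 * b.+1).-1.
rewrite !prednK ?muln_gt0 // !mulrnDl -!mulrnA; congr (_ + _).
  transitivity (v' *+ (k.+1 * a.+1) *+ (l.+1 * b.+1)).
    by rewrite -mulrnA; congr (_ *+ _); lia.
  by rewrite ea -mulrnA; congr (_ *+ _); lia.
transitivity (w' *+ (k.+1 * b.+1) *+ (m.+1 * a.+1)).
  by rewrite -mulrnA; congr (_ *+ _); lia.
by rewrite eb -mulrnA; congr (_ *+ _); lia.
Qed.

Lemma frac_scaleE c n m v k : c * m.+1%:R = n%:~R ->
  frac_scale c (frac v k) = frac (v *~ n) (k.+1 * m.+1).-1.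
Proof.
move=> cE; rewrite /frac_scale.
have /frac_eqP[a ea] := fracE (frac v k).
move: (fnum _) (fden _) ea => v' l ea.
have [D DE] : exists D, denq c = D.+1%:Z.
  by case: (denq c) (denq_gt0 c) => [[|D]|D] // _; exists D.
have nD : (numq c * m.+1%:Z = n * D.+1%:Z)%R.
  apply: (@intr_inj rat); rewrite !rmorphM /= -cE -DE.
  by rewrite numqE; ring.
apply/frac_eqP; exists a; rewrite DE absz_nat !prednK ?muln_gt0 //.
rewrite !pmulrn -!mulrzA.
transitivity (v' *~ (k.+1 * a.+1)%N *~ (numq c * m.+1%:Z)).
  by rewrite -mulrzA; congr (_ *~ _); rewrite !PoszM; ring.
rewrite -pmulrn ea pmulrn nD -mulrzA; congr (_ *~ _).
by rewrite !PoszM; ring.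
Qed.

Lemma frac_addA : associative frac_add.
Proof.
move=> x y z; have [u [v [w [k [-> -> ->]]]]] := frac3P x y z.
by rewrite !frac_addE addrA.
Qed.

Lemma frac_addC : commutative frac_add.
Proof.
move=> x y; have [u [v [k [-> ->]]]] := frac2P x y.
by rewrite !frac_addE addrC.
Qed.

Lemma frac0E k : frac_zero = frac 0 k.
Proof. by apply/frac_eqP; exists 0%N; rewrite !mul0rn. Qed.

Lemma frac_add0 : left_id frac_zero frac_add.
Proof.
by move=> x; rewrite -[x]fracE (frac0E (fden x)) frac_addE add0r.
Qed.

Lemma frac_addN : left_inverse frac_zero frac_opp frac_add.
Proof.
by move=> x; rewrite -[x]fracE frac_oppE frac_addE addNr -frac0E.
Qed.

HB.instance Definition _ :=
  GRing.isZmodule.Build QN frac_addA frac_addC frac_add0 frac_addN.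

Lemma ratP (c : rat) : exists n m, c * m.+1%:R = n%:~R.
Proof.
have [D DE] : exists D, denq c = D.+1%:Z.
  by case: (denq c) (denq_gt0 c) => [[|D]|D] // _; exists D.
by exists (numq c), D; rewrite numqE DE.
Qed.

Lemma frac_scaleA b c x : frac_scale b (frac_scale c x) = frac_scale (b * c) x.
Proof.
have [n [m e]] := ratP b; have [n' [m' e']] := ratP c.
rewrite -[x]fracE (frac_scaleE _ _ e') (frac_scaleE _ _ e).
rewrite (@frac_scaleE _ (n' * n) (m'.+1 * m.+1).-1).
  rewrite mulrzA; congr frac.
  by rewrite !prednK ?muln_gt0 // mulnA.
rewrite prednK ?muln_gt0 // natrM rmorphM /= -e -e'; ring.
Qed.

Lemma frac_scale1 : left_id 1 frac_scale.
Proof.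
move=> x; rewrite -[x]fracE (@frac_scaleE _ 1 0) ?mulr1 //.
by rewrite mulr1z muln1.
Qed.

Lemma frac_scaleDr : right_distributive frac_scale +%R.
Proof.
move=> c x y; have [n [m e]] := ratP c.
have [u [v [k [-> ->]]]] := frac2P x y.
rewrite -[_ + _]/(frac_add _ _) frac_addE !(frac_scaleE _ _ e).
by rewrite -[RHS]/(frac_add _ _) frac_addE mulrzDl.
Qed.

Lemma frac_scaleDl x : {morph frac_scale^~ x : a b / a + b}.
Proof.
move=> b c; have [n [m e]] := ratP b; have [n' [m' e']] := ratP c.
have eb : b * (m.+1 * m'.+1).-1.+1%:R = (n * m'.+1%:Z)%:~R.
  by rewrite prednK ?muln_gt0 // natrM rmorphM /= -e; ring.
have ec : c * (m.+1 * m'.+1).-1.+1%:R = (n' * m.+1%:Z)%:~R.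
  by rewrite prednK ?muln_gt0 // natrM rmorphM /= -e'; ring.
have ebc : (b + c) * (m.+1 * m'.+1).-1.+1%:R =
           (n * m'.+1%:Z + n' * m.+1%:Z)%:~R.
  by rewrite mulrDl eb ec rmorphD.
rewrite -[x]fracE (frac_scaleE _ _ eb) (frac_scaleE _ _ ec) (frac_scaleE _ _ ebc).
by rewrite -[RHS]/(frac_add _ _) frac_addE mulrzDr.
Qed.

HB.instance Definition _ := GRing.Zmodule_isLmodule.Build rat QN
  frac_scaleA frac_scale1 frac_scaleDr frac_scaleDl.

Definition qtensor (c : rat) (v : N) : QN := c *: frac v 0.

(* (c, v) |-> c \otimes v is the universal biadditive map, so QN is indeed the
   tensor product of Q and N over Z. *)
Lemma qtensorDl v : {morph qtensor^~ v : b c / b + c}.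
Proof. by move=> b c; rewrite /qtensor scalerDl. Qed.

Lemma qtensorDr c : {morph qtensor c : v w / v + w}.
Proof.
move=> v w; rewrite /qtensor -scalerDr; congr (_ *: _).
by rewrite -[RHS]/(frac_add _ _) frac_addE.
Qed.

Lemma fracZ v k : frac v k = qtensor k.+1%:R^-1 v.
Proof.
rewrite /qtensor -[RHS]/(frac_scale _ _) (@frac_scaleE _ 1 k).
  by rewrite mulr1z mul1n.
by rewrite mulVf // pnatr_eq0.
Qed.

Lemma qtensor_universal (W : zmodType) (b : rat -> N -> W) :
  (forall v, {morph b^~ v : c d / c + d}) ->
  (forall c, {morph b c : v w / v + w}) ->
  exists! g : QN -> W, {morph g : x y / x + y} /\
    forall c v, g (qtensor c v) = b c v.
Proof.
move=> bDl bDr.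
have b0r c : b c 0 = 0.
  by apply: (addrI (b c 0)); rewrite -bDr !addr0.
have bMn c v n : b c (v *+ n) = b c v *+ n.
  by elim: n => [|n IH]; rewrite ?mulr0n // !mulrS bDr IH.
have b0l v : b 0 v = 0.
  by apply: (addrI (b 0 v)); rewrite -bDl !addr0.
have bMnl c v n : b (c *+ n) v = b c v *+ n.
  by elim: n => [|n IH]; rewrite ?mulr0n // !mulrS bDl IH.
pose g x := b (fden x).+1%:R^-1 (fnum x).
have gE v k : g (frac v k) = b k.+1%:R^-1 v.
  rewrite /g; have /frac_eqP[a] := fracE (frac v k).
  move: (fnum _) (fden _) => w l e.
  have h c n m u : b (n.+1%:R^-1 * c) u = b (n.+1%:R^-1 * m.+1%:R^-1 * c) (u *+ m.+1).
    rewrite bMn -bMnl; congr (b _ _); rewrite -[RHS]mulr_natr.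
    by rewrite -!mulrA [_^-1 * (c * _)]mulrCA mulVf ?mulr1 ?pnatr_eq0.
  have {}h n m u : b n.+1%:R^-1 u = b (n.+1 * m.+1)%:R^-1 (u *+ m.+1).
    by have := h 1 n m u; rewrite !mulr1 natrM invfM.
  rewrite (h l (k.+1 * a.+1).-1) prednK ?muln_gt0 // e.
  rewrite (h k (l.+1 * a.+1).-1) prednK ?muln_gt0 //; congr (b _^-1 _).
  by congr (_%:R); lia.
have gD : {morph g : x y / x + y}.
  move=> x y; have [u [v [k [-> ->]]]] := frac2P x y.
  by rewrite -[_ + _]/(frac_add _ _) frac_addE !gE bDr.
exists g; split=> [|g' [g'D g'E]].
  split=> // c v; have [n [m e]] := ratP c.
  rewrite /qtensor -[_ *: _]/(frac_scale _ _) (frac_scaleE _ _ e).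
  rewrite mul1n gE; have -> : c = m.+1%:R^-1 * n%:~R.
    by rewrite -e mulrC mulfK // pnatr_eq0.
  rewrite mulrzr; case: n {e} => n; first by rewrite -!pmulrn bMn bMnl.
  have bN d w : b d (- w) = - b d w.
    by apply: (addrI (b d w)); rewrite -bDr !subrr b0r.
  have bNl d w : b (- d) w = - b d w.
    by apply: (addrI (b d w)); rewrite -bDl !subrr b0l.
  by rewrite NegzE !mulrNz bN bNl -!pmulrn bMn bMnl.
apply/funext => x; rewrite -[x]fracE fracZ g'E -fracZ gE //.
Qed.

End Rationalization.

Section RationalizationMap.
Variables (N : zmodType) (phi : {additive N -> N}).

Definition qtensor_map (x : rationalization N) : rationalization N :=
  frac (phi (fnum x)) (fden x).

Lemma qtensor_map_frac v k : qtensor_map (frac v k) = frac (phi v) k.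
Proof.
have /frac_eqP[u e] := fracE (frac v k).
by apply/frac_eqP; exists u; rewrite -[LHS](raddfMn phi) e raddfMn.
Qed.

Lemma qtensor_map_is_linear : linear qtensor_map.
Proof.
move=> c x y; have [u [v [k [-> ->]]]] := frac2P x y.
have [n [m e]] := ratP c.
have e0 : frac v k = frac (v *+ m.+1) (k.+1 * m.+1).-1 by exact: frac_mulrn.
rewrite {1}e0 -[c *: _]/(frac_scale _ _) (frac_scaleE _ _ e).
rewrite -[_ + _]/(frac_add _ _) frac_addE !qtensor_map_frac.
rewrite -[c *: _]/(frac_scale _ _) (frac_scaleE _ _ e).
rewrite (frac_mulrn (phi v) k m) -[RHS]/(frac_add _ _) frac_addE.
by rewrite raddfD raddfMz raddfMn.
Qed.

HB.instance Definition _ := GRing.isLinear.Build rat (rationalization N)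
  (rationalization N) _ qtensor_map qtensor_map_is_linear.

Lemma qtensor_mapE c v : qtensor_map (qtensor c v) = qtensor c (phi v).
Proof. by rewrite linearZ /= qtensor_map_frac. Qed.

End RationalizationMap.

(* A module V with an endomorphism T, seen as an R[x]-module with x acting
   as T. *)

Section PolyModule.
Variables (R : comNzRingType) (V : lmodType R) (T : {linear V -> V}).

Definition polymod (_ : {linear V -> V}) : Type := V.
Local Notation M := (polymod T).
HB.instance Definition _ := GRing.Zmodule.on M.

Definition polymod_scale (p : {poly R}) (v : M) : M :=
  \sum_(i < size p) p`_i *: iter i T v.

Lemma polymod_scaleE n (p : {poly R}) v : (size p <= n)%N ->
  polymod_scale p v = \sum_(i < n) p`_i *: iter i T v.
Proof.
move=> le; rewrite /polymod_scale.
rewrite (big_ord_widen n (fun i => p`_i *: iter i T v) le) big_mkcond /=.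
apply: eq_bigr => i _; case: ltnP => // h.
by rewrite nth_default // scale0r.
Qed.

Lemma iterD k : {morph iter k T : v w / v + w}.
Proof. by elim: k => [//|k IH] v w /=; rewrite IH raddfD. Qed.

Lemma iterZ k c v : iter k T (c *: v) = c *: iter k T v.
Proof. by elim: k => [//|k IH] /=; rewrite IH linearZ. Qed.

Lemma polymod_scaleDr : right_distributive polymod_scale +%R.
Proof.
move=> p v w; rewrite /polymod_scale -big_split /=.
by apply: eq_bigr => i _; rewrite iterD scalerDr.
Qed.

Lemma polymod_scaleDl v : {morph polymod_scale^~ v : p q / p + q}.
Proof.
move=> p q; pose n := maxn (size p) (size q).
rewrite !(@polymod_scaleE n) ?leq_maxl ?leq_maxr ?size_polyD //.
by rewrite -big_split; apply: eq_bigr => i _; rewrite coefD scalerDl.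
Qed.

Lemma polymod_scaleC c v : polymod_scale c%:P v = (c *: (v : V) : V).
Proof.
by rewrite (@polymod_scaleE 1) ?size_polyC_leq1 // big_ord1 coefC.
Qed.

Lemma polymod_scaleXM p v :
  polymod_scale ('X * p) v = T (polymod_scale p v).
Proof.
rewrite (@polymod_scaleE (size p).+1); last first.
  by rewrite mulrC (leq_trans (size_polyMleq _ _)) // size_polyX addn2.
rewrite big_ord_recl coefXM eqxx scale0r add0r /polymod_scale raddf_sum.
by apply: eq_bigr => i _; rewrite coefXM /= linearZ.
Qed.

Lemma polymod_scaleX v : polymod_scale 'X v = T v.
Proof. by rewrite -['X]mulr1 polymod_scaleXM -[1]/(1%:P) polymod_scaleC scale1r. Qed.

Lemma polymod_scaleCM c p v :
  polymod_scale (c%:P * p) v = (c *: (polymod_scale p v : V) : V).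
Proof.
rewrite (@polymod_scaleE (size p)); last by rewrite mul_polyC size_scale_leq.
rewrite /polymod_scale scaler_sumr.
by apply: eq_bigr => i _; rewrite coefCM scalerA.
Qed.

Lemma polymod_scaleA p q v :
  polymod_scale p (polymod_scale q v) = polymod_scale (p * q) v.
Proof.
elim/poly_ind: p => [|p c IH].
  by rewrite mul0r /polymod_scale size_poly0 !big_ord0.
rewrite mulrDl !polymod_scaleDl polymod_scaleC polymod_scaleCM; congr (_ + _).
by rewrite mulrC -mulrA !polymod_scaleXM IH.
Qed.

Lemma polymod_scale1 : left_id 1 polymod_scale.
Proof. by move=> v; rewrite polymod_scaleC scale1r. Qed.

HB.instance Definition _ := GRing.Zmodule_isLmodule.Build {poly R} M
  polymod_scaleA polymod_scale1 polymod_scaleDr polymod_scaleDl.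

End PolyModule.

Section CyclicModule.
Variables (F : fieldType) (a : {poly F}).

Definition multiples : {pred {poly F}} := [pred p | a %| p].

Lemma multiples_zmod_closed : zmod_closed multiples.
Proof.
split; first by rewrite inE dvdp0.
by move=> p q; rewrite !inE => hp hq; rewrite dvdp_sub.
Qed.

HB.instance Definition _ :=
  GRing.isZmodClosed.Build {poly F} multiples multiples_zmod_closed.

Definition cyclic_module : Type := Quotient.quot multiples.
HB.instance Definition _ := GRing.Zmodule.on cyclic_module.
Local Notation C := cyclic_module.
Local Notation pr := (\pi_(Quotient.quot multiples)).

Definition cyclic_scale (p : {poly F}) (v : C) : C :=
  pr (p * repr (v : Quotient.quot multiples)).

Lemma cyclic_pi_eq p q : pr p = pr q <-> a %| p - q.
Proof.
rewrite -[a %| _]/(p - q \in multiples) Quotient.idealrBE.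
by split=> [/eqP h|/eqP h]; exact: h.
Qed.

Lemma cyclic_scaleE p q : cyclic_scale p (pr q) = pr (p * q).
Proof.
apply/cyclic_pi_eq; rewrite -mulrBr dvdp_mull //.
by apply/cyclic_pi_eq; rewrite reprK.
Qed.

Lemma cyclicP (v : C) : exists p, v = pr p.
Proof. by exists (repr (v : Quotient.quot multiples)); rewrite reprK. Qed.

Lemma cyclic_scaleA p q v :
  cyclic_scale p (cyclic_scale q v) = cyclic_scale (p * q) v.
Proof. by have [r ->] := cyclicP v; rewrite !cyclic_scaleE mulrA. Qed.

Lemma cyclic_scale1 : left_id 1 cyclic_scale.
Proof. by move=> v; have [r ->] := cyclicP v; rewrite cyclic_scaleE mul1r. Qed.

Lemma cyclic_scaleDr : right_distributive cyclic_scale +%R.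
Proof.
move=> p v w; have [r ->] := cyclicP v; have [t ->] := cyclicP w.
rewrite -[_ + _]/(pr r + pr t) -raddfD !cyclic_scaleE mulrDr.
exact: raddfD.
Qed.

Lemma cyclic_scaleDl v : {morph cyclic_scale^~ v : p q / p + q}.
Proof.
move=> p q; have [r ->] := cyclicP v; rewrite !cyclic_scaleE mulrDl.
exact: raddfD.
Qed.

HB.instance Definition _ := GRing.Zmodule_isLmodule.Build {poly F} C
  cyclic_scaleA cyclic_scale1 cyclic_scaleDr cyclic_scaleDl.

End CyclicModule.

Section DirectSum.
Variables (R : nzRingType) (I : finType) (M : I -> lmodType R).

Definition dsum : Type := {dffun forall i : I, M i}.
HB.instance Definition _ := Choice.on dsum.

Definition dsum_zero : dsum := [ffun i => 0].
Definition dsum_opp (f : dsum) : dsum := [ffun i => - f i].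
Definition dsum_add (f g : dsum) : dsum := [ffun i => f i + g i].
Definition dsum_scale (c : R) (f : dsum) : dsum := [ffun i => c *: f i].

Lemma dsum_addA : associative dsum_add.
Proof. by move=> f g h; apply/ffunP=> i; rewrite !ffunE addrA. Qed.

Lemma dsum_addC : commutative dsum_add.
Proof. by move=> f g; apply/ffunP=> i; rewrite !ffunE addrC. Qed.

Lemma dsum_add0 : left_id dsum_zero dsum_add.
Proof. by move=> f; apply/ffunP=> i; rewrite !ffunE add0r. Qed.

Lemma dsum_addN : left_inverse dsum_zero dsum_opp dsum_add.
Proof. by move=> f; apply/ffunP=> i; rewrite !ffunE addNr. Qed.

HB.instance Definition _ :=
  GRing.isZmodule.Build dsum dsum_addA dsum_addC dsum_add0 dsum_addN.

Lemma dsum_scaleA b c f : dsum_scale b (dsum_scale c f) = dsum_scale (b * c) f.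
Proof. by apply/ffunP=> i; rewrite !ffunE scalerA. Qed.

Lemma dsum_scale1 : left_id 1 dsum_scale.
Proof. by move=> f; apply/ffunP=> i; rewrite !ffunE scale1r. Qed.

Lemma dsum_scaleDr : right_distributive dsum_scale +%R.
Proof. by move=> c f g; apply/ffunP=> i; rewrite !ffunE scalerDr. Qed.

Lemma dsum_scaleDl f : {morph dsum_scale^~ f : b c / b + c}.
Proof. by move=> b c; apply/ffunP=> i; rewrite !ffunE scalerDl. Qed.

HB.instance Definition _ := GRing.Zmodule_isLmodule.Build R dsum
  dsum_scaleA dsum_scale1 dsum_scaleDr dsum_scaleDl.

End DirectSum.

Definition lmod_iso (R : nzRingType) (U V : lmodType R) : Prop :=
  exists f : {linear U -> V}, bijective f.

(* Main.v *)
From HB Require Import structures.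
Require Import Defs.
From mathcomp Require Import all_boot all_order all_algebra all_field.
From mathcomp Require Import generic_quotient ring_quotient.
From mathcomp Require Import boolp classical_sets functions cardinality.
From mathcomp Require Import reals ereal topology normedtype landau.
From mathcomp Require Import counting_measure.
From mathcomp Require Import complex.
From mathcomp Require Import zify ring.

Set Implicit Arguments.
Unset Strict Implicit.
Unset Printing Implicit Defensive.

Import Order.TTheory GRing.Theory Num.Theory.
Local Open Scope ring_scope.

(** A maximal subgroup [H] of [G = N ><| Z] either contains [N], and there is at
    most one such [H] of each index, or maps onto [Z].  In the second case
    [H :&: N] is a maximal [phi]-stable subgroup of [N], the quotient is a simple
    module [S = F_p[x]/(f)] of order [n = p ^ k], where [n] is the index of [H],
    and [H] is one of the [n] complements of [S] in [S ><| Z].  So [m_n(G)] is,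
    up to 1, [n] times the number of quotients of [N] isomorphic to a simple
    module of order [n].  The quotients isomorphic to [F_p[x]/(f)] number
    [(n ^ r - 1) / (n - 1)], where [r] is the rank over [F_p[x]/(f)] of the
    module of functionals [N -> F_p] killed by [f].

    The decomposition of [Q (x) N] gives elements [u_1, ..., u_d] of [N] such
    that, for all but finitely many primes [p], a functional killed by [f] is
    determined by its values on the [phi^i (u_j)] with [i < deg f], and vanishes
    on [u_1] unless [f] divides [a_1] modulo [p]
    (rational_generators, simple_quotient_functional_inj).  Hence [r <= d], and
    [r < d] unless [f] is an irreducible factor of [a_1] modulo [p].  There are
    at most [rho_1] such factors of a given degree, because they divide the
    radical of [a_1], which has degree [rho_1] (integral_radical); the other [f]
    divide the characteristic polynomial of [phi] and so are bounded in number.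
    This is the upper bound.  It is obtained by an injection: instead of
    classifying the quotients, maximal_count encodes each pair of a subgroup
    [H] and a nonzero functional on [N / (H :&: N)] by the polynomial [f], the
    values of the functional on the [phi^i (u_j)] and its values at a point of
    [H] above the generator of [Z].  Small primes do not matter, since [n] is
    at most [p] to the degree of the characteristic polynomial.

    For the lower bound, infinitely many primes [p] are such that [a_1] has
    [rho_1] distinct roots modulo [p] (primes_with_all_roots).  For each root
    [l] and all values [c_j] with [c_1 = 1] there is a functional [h] with
    [h \o phi = l h] and [h (u_j) = c_j], because [a_1] divides every [a_j]
    (eigen_functional_exists).  Each [h] and each [s] in [F_p] define an affine
    action of [G] on the line [F_p], and the stabilisers of 0 are
    [rho_1 * p ^ d.-1 * p] distinct maximal subgroups of index [p]. *)

(** * Irreducible factors and the radical *)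

Lemma irreducible_dvdp_exp (F : fieldType) (f P : {poly F}) m :
  irreducible_poly f -> f %| P ^+ m -> f %| P.
Proof.
move=> irr_f; elim: m => [|m IH]; last first.
  rewrite exprS; have [//|nfP] := boolP (f %| P).
  by rewrite Gauss_dvdpr ?irreducible_poly_coprime // => /IH; rewrite (negPf nfP).
by rewrite expr0 dvdp1; case: irr_f; case: size => [|[]].
Qed.

Lemma irreducible_coprime (F : fieldType) (f g : {poly F}) :
  irreducible_poly f -> irreducible_poly g -> f \is monic -> g \is monic ->
  f != g -> coprimep f g.
Proof.
move=> irr_f irr_g mf mg; apply: contraR.
rewrite irreducible_poly_coprime // negbK.
move=> fg; rewrite -eqp_monic //; apply: apply_irredp fg => //.
by case: irr_f; case: size => [|[]].
Qed.

(** Distinct monic irreducible factors are coprime, so that their product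
    divides [P]. *)
Lemma size_irreducible_factors (F : fieldType) k (P : {poly F})
    (E : seq {poly F}) :
  (0 < k)%N -> P != 0 -> uniq E ->
  (forall f, f \in E ->
     [/\ irreducible_poly f, f \is monic, size f = k.+1 & f %| P]) ->
  (size E <= (size P).-1)%N.
Proof.
move=> k0 P0 uE hE.
have szE : size (\prod_(f <- E) f) = (size E * k).+1.
  elim: E hE {uE} => [|f E IH] hE; first by rewrite big_nil size_poly1.
  have [_ mf sf _] := hE f (mem_head _ _).
  have {}IH := IH (fun g gE => hE g (mem_behead (s := f :: E) gE)).
  rewrite big_cons size_monicM //; last by rewrite -size_poly_eq0 IH.
  by rewrite sf IH /=; lia.
suff /dvdp_leq - /(_ P0) : \prod_(f <- E) f %| P.
  rewrite szE => h; rewrite -ltnS prednK ?size_poly_gt0 //.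
  by apply: leq_trans h; rewrite ltnS leq_pmulr.
elim: E uE hE {szE} => [|f E IH] /=; first by rewrite big_nil dvd1p.
move=> /andP[fE uE] hE; have [irr_f mf sf fP] := hE f (mem_head _ _).
have hE' g (gE : g \in E) := hE g (mem_behead (s := f :: E) gE).
rewrite big_cons Gauss_dvdp ?fP /= ?IH //.
rewrite big_seq; elim/big_rec: _ => [|g Q gE cQ]; first exact: coprimep1.
rewrite coprimepMr cQ andbT; have [irr_g mg _ _] := hE' g gE.
by apply: irreducible_coprime => //; apply: contraNneq fE => ->.
Qed.

(** In characteristic 0 the multiplicity of a root drops by exactly 1 in the
    derivative. *)
Lemma root_divp_deriv_gcd (F : fieldType) (p : {poly F}) z :
  (forall m, m.+1%:R != 0 :> F) -> p != 0 -> root p z ->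
  root (p %/ gcdp p p^`()) z.
Proof.
move=> ch0 p0 pz; set g := gcdp p p^`(); set B := p %/ g.
have gB : p = B * g by rewrite divpK // dvdp_gcdl.
have [m [s]] := multiplicity_XsubC p z; rewrite p0 /= => sz ps.
case: m ps => [|m] ps.
  by move: pz; rewrite ps expr0 mulr1 => pz; rewrite pz in sz.
apply: contraT => Bz.
have cop : coprimep (('X - z%:P) ^+ m.+1) B.
  by rewrite coprimep_expl // coprimep_sym coprimep_XsubC.
have : ('X - z%:P) ^+ m.+1 %| g.
  by rewrite -(Gauss_dvdpr _ cop) -gB ps dvdp_mulIr.
move=> /dvdp_trans/(_ (dvdp_gcdr p p^`())).
rewrite ps derivM deriv_exp derivXsubC mul1r.

rewrite dvdp_addr ?dvdp_mulIr // exprS -scaler_nat -scalerAr.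
rewrite dvdpZr //.
rewrite mulrC [s * _]mulrC dvdp_mul2l ?expf_neq0 ?polyXsubC_eq0 //.
by rewrite dvdp_XsubCl (negPf sz).
Qed.

(** The quotient [B] of [p] by the gcd of [p] and its derivative is separable
    and has the roots of [p].  Over an algebraically closed field each linear
    factor of [p] divides [B], hence a power of [B] is a multiple of [p]; this
    divisibility descends to the rationals. *)
Lemma rational_radical (C : numClosedFieldType) (p : {poly rat}) rho :
  p != 0 ->
  ([set z : C | root (map_poly ratr p) z]%classic #= `I_rho)%card ->
  exists B : {poly rat}, [/\ separable_poly B, (size B).-1 = rho, B %| p &
    exists m, p %| B ^+ m].
Proof.
move=> p0 card_rho; set B := p %/ gcdp p p^`().
have sepB : separable_poly B by exact: make_separable.
have Bp : B %| p by rewrite divp_dvd // dvdp_gcdl.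
have pC0 : map_poly (ratr : rat -> C) p != 0 by rewrite map_poly_eq0.
pose pC : {poly C} := map_poly ratr p.
have BE : map_poly ratr B = pC %/ gcdp pC pC^`().
  by rewrite map_divp gcdp_map deriv_map.
have rootB (z : C) : root (map_poly ratr B) z = root (map_poly ratr p) z.
  apply/idP/idP => [|pz].
    by rewrite -!dvdp_XsubCl => /dvdp_trans; apply; rewrite dvdp_map.
  by rewrite BE; apply: root_divp_deriv_gcd => // m; rewrite pnatr_eq0.
exists B; split=> //.
  have [r rE] := closed_field_poly_normal (map_poly (ratr : rat -> C) B).
  have lc : lead_coef (map_poly (ratr : rat -> C) B) != 0.
    rewrite lead_coef_eq0 map_poly_eq0; apply: contraNneq p0 => B0.
    by rewrite B0 dvd0p in Bp.
  have rE' : map_poly ratr B %= \prod_(z <- r) ('X - z%:P).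
    by rewrite rE eqp_scale.
  have ur : uniq r.
    rewrite -separable_prod_XsubC -(eqp_separable rE').
    by rewrite -(separable_map (@ratr C)) in sepB.
  have -> : (size B).-1 = size r.
    by rewrite -(size_map_poly (@ratr C)) (eqp_size rE') size_prod_XsubC.
  have fin : finite_set [set z : C | root (map_poly ratr p) z]%classic.
    by apply/finite_setP; exists rho.
  rewrite -(card_fset_set card_rho); apply/perm_size/uniq_perm => // [|z].
    exact: finmap.fset_uniq.
  rewrite in_fset_set // -root_prod_XsubC -(eqp_root rE') rootB.
  by apply/idP/idP; rewrite inE.
exists (size p).
have [r rE] := closed_field_poly_normal (map_poly (ratr : rat -> C) p).
rewrite -(dvdp_map (@ratr C)) rmorphXn /= rE dvdpZl ?lead_coef_eq0 //.
have szr : (size r <= size p)%N.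
  rewrite -(size_map_poly (@ratr C)) rE size_scale ?lead_coef_eq0 //.
  by rewrite size_prod_XsubC.
apply: (@dvdp_trans _ (map_poly ratr B ^+ size r)); last exact: dvdp_exp2l.
have /allP : forall z, z \in r -> 'X - z%:P %| map_poly (@ratr C) B.
  move=> z zr; rewrite dvdp_XsubCl rootB rE rootZ ?lead_coef_eq0 //.
  by rewrite root_prod_XsubC.
elim: r {rE szr} => [|z r IH] /=; first by rewrite big_nil dvd1p.
by move=> /andP[zB rB]; rewrite big_cons exprS dvdp_mul // IH.
Qed.

(** * Primes modulo which a polynomial splits *)

Lemma intr_Fp_eq0 p (z : int) : prime p -> (z%:~R == 0 :> 'F_p) = (p %| `|z|)%N.
Proof.
move=> p_pr; rewrite (dvdn_pcharf (pchar_Fp p_pr)).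
by case: z => n; rewrite ?NegzE ?mulrNz ?oppr_eq0 ?abszN -pmulrn.
Qed.

Lemma exists_nat_nonroot (h : {poly int}) :
  h != 0 -> exists t : nat, h.[t%:Z] != 0.
Proof.
move=> h0; apply: contrapT => /forallNP all_root.
suff : (size h < size h)%N by rewrite ltnn.
rewrite -{1}(size_iota 0 (size h)) -(size_map Posz).
apply: max_poly_roots => //; last first.
  by rewrite map_inj_uniq ?iota_uniq // => i j [].
apply/allP => _ /mapP[i _ ->]; apply/negPn/negP => hi; exact: (all_root i).
Qed.

(** Schur's argument: writing [g(0) = c], the integers [g(c * N`! * t) / c] are
    congruent to 1 modulo [N`!], so that their prime factors exceed [N]; they
    are units for finitely many [t] only. *)
Lemma prime_with_root (g : {poly int}) (N : nat) : (1 < size g)%N ->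
  exists p, [/\ prime p, (N < p)%N &
    exists t : 'F_p, root (map_poly intr g) t].
Proof.
move=> sg; set c := g.[0].
have horner_intr p (x : int) : (map_poly intr g).[x%:~R] = g.[x]%:~R :> 'F_p.
  by rewrite horner_map.
have [c0|c0] := eqVneq c 0.
  have [p Np p_pr] := prime_above N; exists p; split => //.
  by exists (0%:~R); rewrite rootE horner_intr -/c c0.
have [e ge] : exists e, g = e * 'X + c%:P.
  have /factor_theorem[e] : root (g - c%:P) 0.
    by rewrite rootE !hornerE -/c subrr.
  by rewrite subr0 => ge; exists e; rewrite -ge subrK.
set m : int := N`!%:Z.
have m0 : m != 0 by rewrite /m; have := fact_gt0 N; lia.
(* A point where [h] does not vanish is one where [w] is not 0, 1 or -1. *)
pose h := (g * ((g - c%:P) * (g + c%:P))) \Po ((c * m) *: 'X).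
have sN (a : int) : (1 < size (g + a%:P)%R)%N.
  by rewrite size_polyDl // (leq_ltn_trans (size_polyC_leq1 _)).
have h0 : h != 0.
  rewrite -size_poly_eq0 size_comp_poly2 ?size_scale ?size_polyX ?mulf_neq0 //.
  have nz (q : {poly int}) : (1 < size q)%N -> q != 0.
    by rewrite -size_poly_eq0; case: size.
  by rewrite size_poly_eq0 !mulf_neq0 ?nz // -polyCN sN.
have [t] := exists_nat_nonroot h0.
rewrite horner_comp !(hornerM, hornerD, hornerN, hornerC, hornerZ, hornerX).
set x := c * m * t%:Z.
set w := 1 + m * t%:Z * e.[x].
have gx : g.[x] = c * w.
  by rewrite {1}ge hornerD hornerMX hornerC /w /x; ring.
rewrite gx => hx.
have w1 : (1 < `|w|)%N.
  have : w != 0 /\ w != 1 /\ w != -1; last by lia.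
  by split; last split; apply: contraNneq hx => ->; apply/eqP; ring.
exists (pdiv `|w|); split; first exact: pdiv_prime.
  rewrite ltnNge; apply/negP => le.
  have dm : ((pdiv `|w|)%:Z %| m)%Z.
    by rewrite dvdzE !absz_nat dvdn_fact // pdiv_gt0.
  have : ((pdiv `|w|)%:Z %| w - m * t%:Z * e.[x])%Z.
    by rewrite rpredB ?dvdz_mulr // dvdzE absz_nat pdiv_dvd.
  rewrite /w addrK dvdzE absz_nat dvdn1 => /eqP p1.
  by have := pdiv_prime w1; rewrite p1.
exists (x%:~R); rewrite rootE horner_intr intr_Fp_eq0 ?pdiv_prime // gx abszM.
by rewrite dvdn_mull // pdiv_dvd.
Qed.

Local Notation pZtoQ := (map_poly (intr : int -> rat)).

Lemma rat_seq_common_denominator (ps : seq {poly rat}) :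
  exists2 D : int, D != 0 & exists Is : seq {poly int},
    map pZtoQ Is = map ( *:%R D%:~R) ps.
Proof.
elim: ps => [|q ps [D D0 [Is IsE]]]; first by exists 1 => //; exists [::].
have [I [a a0 qE]] := rat_poly_scale q.
exists (a * D); first exact: mulf_neq0.
exists ((D *: I) :: map ( *:%R a) Is) => /=; congr (_ :: _).
  rewrite map_polyZ /= qE scalerA rmorphM /= mulrAC mulfV ?mul1r // intr_eq0 //.
transitivity (map ( *:%R a%:~R) (map pZtoQ Is)).
  by rewrite -!map_comp; apply: eq_map => J /=; rewrite map_polyZ.
by rewrite IsE -map_comp; apply: eq_map => J /=; rewrite scalerA rmorphM.
Qed.

(** Scaling the roots by [D] multiplies each coefficient by a power of [D]:
    this keeps the coefficients integral. *)
Definition scale_roots (D : int) (B : {poly int}) : {poly int} :=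
  \poly_(k < size B) (B`_k * D ^+ ((size B).-1 - k)).

Lemma horner_scale_roots (S : comNzRingType) D B (y : S) :
  (map_poly intr (scale_roots D B)).[D%:~R * y] =
    D%:~R ^+ (size B).-1 * (map_poly intr B).[y].
Proof.
rewrite (@horner_coef_wide _ (size B)); last first.
  by rewrite (leq_trans (size_poly _ _)) // size_poly.
rewrite [in RHS](@horner_coef_wide _ (size B)) ?size_poly // mulr_sumr.
apply: eq_bigr => i _; rewrite !coef_map /= coef_poly ltn_ord rmorphM rmorphXn /=.
have /subnK {2}<- : (i <= (size B).-1)%N by have := ltn_ord i; lia.
by rewrite exprMn exprD; ring.
Qed.

(** A Bezout relation with integral coefficients has a nonzero integer as its
    right-hand side; primes larger than this integer do not divide it. *)
Lemma no_common_root_mod_large_primes (P Q : {poly int}) :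
  coprimep (pZtoQ P) (pZtoQ Q) ->
  exists N : nat, forall p, prime p -> (N < p)%N -> forall t : 'F_p,
    root (map_poly intr P) t -> ~~ root (map_poly intr Q) t.
Proof.
move=> /Bezout_eq1_coprimepP[[u v] /= uv].
have [E E0 [Is IsE]] := rat_seq_common_denominator [:: u; v].
case: Is IsE => [|al [|be [|? ?]]] //= [alE beE].
have {uv u v alE beE} EE : al * P + be * Q = E%:P.
  apply: (map_inj_poly (@intr_inj rat) (mulr0z _)).
  rewrite rmorphD !rmorphM /= alE beE -!scalerAl -scalerDr uv map_polyC /=.
  by rewrite alg_polyC.
exists `|E|%N => p p_pr lt t; rewrite !rootE => /eqP Pt.
apply/negP => /eqP Qt.
have /(congr1 (fun x => (map_poly intr x).[t])) := EE.
rewrite rmorphD !rmorphM /= map_polyC !hornerE Pt Qt !mulr0 addr0 => /esym/eqP.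
by rewrite intr_Fp_eq0 // => /dvdn_leq; lia.
Qed.

(** The roots of [B] are polynomials in a primitive element [z] of the
    splitting field of [B]; a root modulo [p] of the minimal polynomial of [z]
    is thus mapped to roots of [B] modulo [p], and these are distinct for
    large [p]. *)
Lemma primes_with_all_roots (B : {poly int}) (N : nat) :
  separable_poly (pZtoQ B) ->
  exists p, [/\ prime p, (N < p)%N & exists l : seq 'F_p,
    [/\ uniq l, size l = (size B).-1 & all (root (map_poly intr B)) l]].
Proof.
move=> sepB; set s := (size B).-1.
have B0 : B != 0.
  apply: contraTneq sepB => ->; rewrite rmorph0; apply/negP => sep0.
  have := separable_nosquare (u := 'X) sep0 (ltnSn 1).
  by rewrite size_polyX dvdp0 => /(_ isT).
pose BC : {poly algC} := map_poly intr B.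
have BCE : BC = map_poly ratr (pZtoQ B).
  by rewrite -map_poly_comp; apply: eq_map_poly => x /=; rewrite rmorph_int.
have [r rE] := closed_field_poly_normal BC.
have BC0 : BC != 0 by rewrite map_poly_eq0_id0 ?intr_eq0 ?lead_coef_eq0.
have rE' : BC %= \prod_(z <- r) ('X - z%:P).
  by rewrite rE eqp_scale ?lead_coef_eq0.
have ur : uniq r.
  rewrite -separable_prod_XsubC -(eqp_separable rE') BCE.
  by rewrite separable_map.
have szr : size r = s.
  have : size BC = (size r).+1 by rewrite (eqp_size rE') size_prod_XsubC.
  by rewrite BCE size_map_poly size_rat_int_poly /s => ->.
have [z _ /sig_eqW[ps rps]] := algC_PET r.
have [D D0 [Is IsE]] := rat_seq_common_denominator ps.
have szI : size Is = s.
  by rewrite -szr rps size_map -[RHS](size_map ( *:%R D%:~R)) -IsE size_map.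
have rI i : (i < s)%N -> (map_poly intr Is`_i).[z] = D%:~R * r`_i.
  move=> lt; have szps : size ps = s by rewrite -szr rps size_map.
  rewrite [in RHS]rps (nth_map 0) ?szps //.
  have -> : map_poly intr Is`_i = map_poly ratr (pZtoQ Is`_i) :> {poly algC}.
    by rewrite -map_poly_comp; apply: eq_map_poly => x /=; rewrite rmorph_int.
  rewrite -(nth_map 0 0 pZtoQ) ?szI // IsE (nth_map 0) ?szps //.
  by rewrite map_polyZ /= hornerZ rmorph_int.
have [mp [_ mp_monic] mpP] := minCpolyP z.
have [G [a a0 GE]] := rat_poly_scale mp.
have rootG (P : {poly int}) : root (map_poly intr P) z = (pZtoQ G %| pZtoQ P).
  have -> : map_poly intr P = map_poly ratr (pZtoQ P) :> {poly algC}.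
    by rewrite -map_poly_comp; apply: eq_map_poly => x /=; rewrite rmorph_int.
  by rewrite mpP GE dvdpZl // invr_eq0 intr_eq0.
have mpG : mp %= pZtoQ G by rewrite GE eqp_scale // invr_eq0 intr_eq0.
have root_mp : root (map_poly ratr mp) z by rewrite mpP.
have szG : (1 < size (zprimitive G))%N.
  rewrite size_zprimitive -size_rat_int_poly -(eqp_size mpG).
  rewrite -(size_map_poly (@ratr algC)); apply: root_size_gt1 root_mp.
  by rewrite map_poly_eq0 monic_neq0.
have evalG p (t : 'F_p) (P : {poly int}) : root (map_poly intr P) z ->
    root (map_poly intr (zprimitive G)) t -> root (map_poly intr P) t.
  rewrite rootG dvdp_rat_int => /dvdpP_int[Q ->] Gt.
  by rewrite rmorphM rootM Gt.
(* The minimal polynomial divides a product only if it divides a factor. *)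
have copG (P : {poly int}) : ~~ root (map_poly intr P) z ->
    coprimep (pZtoQ (zprimitive G)) (pZtoQ P).
  move=> Pz; have mpE : mp %= pZtoQ (zprimitive G).
    rewrite (eqp_trans mpG) // [in pZtoQ G](zpolyEprim G) map_polyZ /= eqp_scale //.
    rewrite intr_eq0 zcontents_eq0; apply: contraTneq szG => ->.
    by rewrite zprimitive0 size_poly0.
  rewrite -(eqp_coprimepl _ mpE) coprimep_def.
  set g := gcdp _ _; have gmp : g %| mp := dvdp_gcdl _ _.
  have [e eg] := dvdpP _ _ gmp.
  have : root (map_poly ratr (e * g)) z by rewrite -eg.
  rewrite rmorphM rootM !mpP => /orP[mpe|mpg]; last first.
    case/negP: Pz; rewrite rootG -(eqp_dvdl _ mpG).
    exact: dvdp_trans mpg (dvdp_gcdr _ _).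
  have mp0 := monic_neq0 mp_monic.
  have e0 : e != 0 by apply: contraNneq mp0 => e0; rewrite eg e0 mul0r.
  have g0 : g != 0 by apply: contraNneq mp0 => g0; rewrite eg g0 mulr0.
  have := dvdp_leq e0 mpe; rewrite {1}eg size_mul //.
  move: e0 g0; rewrite -!size_poly_gt0; move: (size e) (size g) => x y.
  by clear; lia.
pose pair := ('I_s * 'I_s)%type.
have /fin_all_exists[N0 N0P] : forall ij : pair, exists N0 : nat, ij.1 != ij.2 ->
    forall p, prime p -> (N0 < p)%N -> forall t : 'F_p,
    root (map_poly intr (zprimitive G)) t ->
    ~~ root (map_poly intr (Is`_ij.1 - Is`_ij.2)) t.
  move=> [i j] /=; have [->|ij] := eqVneq i j; first by exists 0%N.
  suff /copG/no_common_root_mod_large_primes[N0 H] :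
      ~~ root (map_poly intr (Is`_i - Is`_j)) z by exists N0.
  rewrite rootE rmorphB hornerD hornerN !rI // -mulrBr mulf_eq0 intr_eq0.
  by rewrite (negPf D0) subr_eq0 nth_uniq ?szr.
have [p [p_pr ltp [t Gt]]] :=
  prime_with_root (N + `|D| + \max_(ij : pair) N0 ij)%N szG.
exists p; split => //.
  by rewrite (leq_ltn_trans _ ltp) // -addnA leq_addr.
have Dp : D%:~R != 0 :> 'F_p.
  rewrite intr_Fp_eq0 //; apply/negP => /dvdn_leq; rewrite absz_gt0 => /(_ D0).
  apply/negP; rewrite -ltnNge (leq_ltn_trans _ ltp) //.
  by rewrite addnAC leq_addl.
exists [seq D%:~R^-1 * (map_poly intr J).[t] | J : {poly int} <- Is]; split.
- apply/(uniqP 0) => i j; rewrite !inE !size_map szI => lti ltj.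
  rewrite !(nth_map 0) ?szI // => /(mulfI (invr_neq0 Dp)) eqt.
  apply/eqP; apply: contraT => ij.
  have ltp' : (N0 (Ordinal lti, Ordinal ltj) < p)%N.
    by apply: leq_ltn_trans (leq_trans (leq_bigmax _) (leq_addl _ _)) ltp.
  have := N0P (Ordinal lti, Ordinal ltj) ij p p_pr ltp' t Gt.
  by rewrite rootE rmorphB /= hornerD hornerN eqt subrr eqxx.
- by rewrite size_map.
apply/allP => _ /mapP[J JIs ->].
have [i lti <-] := nthP 0 JIs; rewrite szI in lti.
set y := _ * _; rewrite rootE.
have := horner_scale_roots D B y; rewrite /y mulVKf // => /esym/eqP.
suff /evalG/(_ Gt) : root (map_poly intr (scale_roots D B \Po Is`_i)) z.
  rewrite rootE map_comp_poly horner_comp => /eqP ->.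
  by rewrite mulf_eq0 expf_eq0 (negPf Dp) andbF.
rewrite rootE map_comp_poly horner_comp rI // horner_scale_roots.
rewrite mulf_eq0 -rootE -/BC (eqp_root rE') root_prod_XsubC mem_nth ?orbT //.
by rewrite szr.
Qed.

Lemma rat_poly_primitive (q : {poly rat}) : q != 0 ->
  exists Q : {poly int}, [/\ pZtoQ Q %= q, zprimitive Q = Q & zcontents Q = 1].
Proof.
move=> q0; have [Q [a a0 qE]] := rat_poly_scale q.
have Q0 : Q != 0 by apply: contraNneq q0 => Q0; rewrite qE Q0 rmorph0 scaler0.
have c1 : zcontents (zprimitive Q) = 1 by rewrite zcontents_primitive Q0.
exists (zprimitive Q); split=> //.
  have e1 : q %= pZtoQ Q by rewrite qE eqp_scale ?invr_eq0 ?intr_eq0.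
  have e2 : pZtoQ Q %= pZtoQ (zprimitive Q).
    rewrite {1}(zpolyEprim Q) map_polyZ /= eqp_scale //.
    by rewrite intr_eq0 zcontents_eq0.
  by rewrite eqp_sym (eqp_trans e1 e2).
by rewrite [RHS]zpolyEprim c1 scale1r.
Qed.

Lemma primitive_mod_prime_neq0 p (Q : {poly int}) : prime p ->
  zcontents Q = 1 -> map_poly intr Q != 0 :> {poly 'F_p}.
Proof.
move=> p_pr c1; apply/eqP => Q0.
have : (p%:Z %| zcontents Q)%Z.
  rewrite dvdz_contents; apply/polyOverP => i.
  rewrite dvdzE absz_nat -intr_Fp_eq0 //.
  by have /(congr1 (fun P : {poly _} => P`_i)) := Q0; rewrite coef_map coef0 => /eqP.
by rewrite c1 dvdzE absz_nat dvdn1 => /eqP p1; rewrite p1 in p_pr.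
Qed.

(** Integral models of a rational polynomial and of its radical.  By the lemma
    of Gauss the divisibilities hold over the integers, so that they can be
    reduced modulo every prime. *)
Lemma integral_radical (C : numClosedFieldType) (a : {poly rat}) rho :
  a != 0 ->
  ([set z : C | root (map_poly ratr a) z]%classic #= `I_rho)%card ->
  exists A B : {poly int},
    [/\ pZtoQ A %= a, zprimitive A = A,
        [/\ separable_poly (pZtoQ B), (size B).-1 = rho &
            forall p, prime p -> map_poly intr B != 0 :> {poly 'F_p}],
        exists r, A = B * r & exists m r, B ^+ m = A * r].
Proof.
move=> a0 card_rho.
have [b [sep_b sz_b ba [m abm]]] := rational_radical a0 card_rho.
have b0 : b != 0 by apply: contraNneq a0 => b0; rewrite -dvd0p -b0.
have [A [Aa Aprim _]] := rat_poly_primitive a0.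
have [B [Bb Bprim B1]] := rat_poly_primitive b0.
exists A, B; split=> //.
- split; first by rewrite (eqp_separable Bb).
    by rewrite -sz_b -(eqp_size Bb) size_rat_int_poly.
  by move=> p p_pr; apply: primitive_mod_prime_neq0.
- have /dvdpP_int[r ->] : B %| A.
    by rewrite -dvdp_rat_int (eqp_dvdl _ Bb) (eqp_dvdr _ Aa).
  by exists r; rewrite Bprim.
exists m; have /dvdpP_int[r ->] : A %| B ^+ m.
  rewrite -dvdp_rat_int rmorphXn /= (eqp_dvdl _ Aa).
  by rewrite (eqp_dvdr _ (eqp_exp _ Bb)).
by exists r; rewrite Aprim.
Qed.

(** * The action of integral polynomials on N *)

Local Notation "M ^z" := (zmodule M) : type_scope.

Section ZxAction.
Variables (N : zmodType) (phi : {additive N -> N}).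

(** [phi] seen as a [Z]-linear map, so that [polymod zphi] is the
    [Z[x]]-module of the theorem. *)
Definition zphi (v : N^z) : N^z := phi v.

Lemma zphi_is_linear : linear zphi.
Proof. by move=> c x y; rewrite /zphi raddfD scalezrE raddfMz. Qed.

HB.instance Definition _ := GRing.isLinear.Build int N^z N^z _ zphi zphi_is_linear.

Definition zact (P : {poly int}) (v : N) : N := @polymod_scale _ _ (@zphi) P v.

Lemma zactDr P v w : zact P (v + w) = zact P v + zact P w.
Proof. exact: (@polymod_scaleDr _ _ (@zphi)). Qed.

Lemma zactDl P Q v : zact (P + Q) v = zact P v + zact Q v.
Proof. exact: (@polymod_scaleDl _ _ (@zphi)). Qed.

Lemma zactA P Q v : zact (P * Q) v = zact P (zact Q v).
Proof. exact/esym/(@polymod_scaleA _ _ (@zphi)). Qed.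

Lemma zactC c v : zact c%:P v = v *~ c.
Proof. exact: (@polymod_scaleC _ _ (@zphi)). Qed.

Lemma zact1 v : zact 1 v = v.
Proof. by rewrite -[1]/(1%:P) zactC. Qed.

Lemma zactX v : zact 'X v = phi v.
Proof. exact: (@polymod_scaleX _ _ (@zphi)). Qed.

Lemma zactXn i v : zact 'X^i v = iter i phi v.
Proof. by elim: i v => [|i IH] v; rewrite ?zact1 // exprS zactA zactX IH. Qed.

Fact zact_is_additive P : zmod_morphism (zact P).
Proof.
have zact0 : zact P 0 = 0 by apply: (addrI (zact P 0)); rewrite -zactDr !addr0.
move=> v w; rewrite zactDr; congr (_ + _).
by apply: (addrI (zact P w)); rewrite -zactDr !subrr zact0.
Qed.
HB.instance Definition _ P :=
  GRing.isZmodMorphism.Build N N (zact P) (zact_is_additive P).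

Lemma zact0l v : zact 0 v = 0.
Proof. by apply: (addrI (zact 0 v)); rewrite -zactDl !addr0. Qed.

Lemma zact_suml (I : Type) (r : seq I) (P : I -> {poly int}) v :
  zact (\sum_(i <- r) P i) v = \sum_(i <- r) zact (P i) v.
Proof. exact: (big_morph (zact^~ v) (fun P Q => zactDl P Q v) (zact0l v)). Qed.

Lemma zactCM c P v : zact (c%:P * P) v = zact P v *~ c.
Proof. by rewrite mulrC zactA zactC raddfMz. Qed.

(** Used for the embedding into [Q (x) N] and for the simple quotients of [N]. *)
Lemma zact_morph (F : comNzRingType) (V : lmodType F) (T : {linear V -> V})
    (q : {additive N -> V}) :
  (forall v, q (phi v) = T (q v)) ->
  forall P v, q (zact P v) = @polymod_scale _ _ T (map_poly intr P) (q v).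
Proof.
move=> qT P v.
have qiter i : q (iter i phi v) = iter i T (q v).
  by elim: i => //= i IH; rewrite qT IH.
rewrite (@polymod_scaleE _ _ _ (size P)) ?size_poly // /zact /polymod_scale.
rewrite raddf_sum; apply: eq_bigr => i _.
by rewrite coef_map /= raddfMz -scaler_int qiter.
Qed.

End ZxAction.

Local Notation frac := Defs.frac.

Section RationalGenerators.
Variables (N : zmodType) (phi : {additive N -> N}).

Definition embQ (v : N) : rationalization N := frac v 0.

Fact embQ_is_additive : zmod_morphism embQ.
Proof.
move=> v w; rewrite /embQ -[RHS]/(frac_add _ (frac_opp _)).
by rewrite frac_oppE frac_addE.
Qed.
HB.instance Definition _ :=
  GRing.isZmodMorphism.Build N (rationalization N) embQ embQ_is_additive.

(** The kernel of [N -> Q (x) N] is the torsion of [N]. *)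
Lemma embQ_eq0 (v : N) : embQ v = 0 <-> exists2 m, (0 < m)%N & v *+ m = 0.
Proof.
rewrite -[0]/(frac_zero N) /embQ frac_eqP; split=> [[u]|[[//|m] _ e]].
  by rewrite mul1n mul0rn; exists u.+1.
by exists m; rewrite mul1n mul0rn.
Qed.

Lemma embQ_zact P v :
  embQ (zact phi P v) =
    (pZtoQ P *: (embQ v : polymod (qtensor_map phi)) :
       polymod (qtensor_map phi)).
Proof.
apply: (zact_morph (q := embQ) (T := qtensor_map phi)).
by move=> w; rewrite /= /embQ qtensor_map_frac.
Qed.

Section Sum.
Variables (I : finType) (a : I -> {poly rat}).
Local Notation pr i := (\pi_(Quotient.quot (multiples (a i)))%qT).
Local Notation C := (fun j => cyclic_module (a j)).

Lemma dsum_sumE (R : nzRingType) (M : I -> lmodType R) (J : finType)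
    (f : J -> dsum M) i : (\sum_j f j) i = \sum_j (f j) i.
Proof.
apply: (big_morph (fun g : dsum M => g i)) => [g h|]; exact: ffunE.
Qed.

Definition dsum_basis (j : I) : dsum C := [ffun i => pr i (i == j)%:R].

Lemma dsum_basis_comb (P : I -> {poly rat}) :
  \sum_j P j *: dsum_basis j = [ffun i => pr i (P i)] :> dsum C.
Proof.
apply/ffunP => i; rewrite dsum_sumE ffunE (bigD1 i) //= big1 ?addr0.
  by rewrite ffunE ffunE -[LHS]/(cyclic_scale _ _) cyclic_scaleE eqxx mulr1.
move=> j ji; rewrite ffunE ffunE -[LHS]/(cyclic_scale _ _) cyclic_scaleE.
by rewrite eq_sym (negPf ji) mulr0 -[RHS](raddf0 (pr i)).
Qed.

End Sum.

(** Some multiple of the generator of each cyclic summand of [Q (x) N] lifts to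
    [N].  The lifts [u] describe [N] up to bounded torsion: the multiples by [M]
    are combinations of the [u j], since [N] is finitely generated, and a
    relation between the [u j] can be read in each summand. *)
Lemma rational_generators (I : finType) (a : I -> {poly rat}) :
  finitely_generated_zmod N ->
  lmod_iso (polymod (qtensor_map phi)) (dsum (fun j => cyclic_module (a j))) ->
  exists u : I -> N,
    [/\ exists2 M, (0 < M)%N &
          forall v, exists P, v *+ M = \sum_j zact phi (P j) (u j),
        forall P, \sum_j zact phi (P j) (u j) = 0 -> forall j, a j %| pZtoQ (P j) &
        forall j A, a j %| pZtoQ A ->
          exists2 m, (0 < m)%N & zact phi A (u j) *+ m = 0].
Proof.
move=> [k [g gP]] [F [F' FK F'K]].
pose M := polymod (qtensor_map phi).
have FI : injective F := can_inj FK.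
pose e := dsum_basis a.
pose u j := fnum (F' (e j)); pose s j : rat := (fden (F' (e j))).+1%:R.
have s0 j : s j != 0 by rewrite pnatr_eq0.
have Fu j : F (embQ (u j)) = (s j)%:P *: e j.
  rewrite -[X in _ *: X]F'K -linearZ /=; congr (F _).
  rewrite -[RHS]/(polymod_scale _ _) polymod_scaleC -[X in _ *: X]fracE fracZ.
  by rewrite /qtensor scalerA mulfV // scale1r.
have Fsum P : F (embQ (\sum_j zact phi (P j) (u j))) =
    [ffun i => \pi_(Quotient.quot (multiples (a i)))%qT (s i *: pZtoQ (P i))].
  rewrite -dsum_basis_comb raddf_sum /= linear_sum; apply: eq_bigr => j _.
  by rewrite embQ_zact linearZ /= Fu scalerA mulrC mul_polyC.
have F0 : F (embQ 0) = 0.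
  exact (etrans (congr1 F (raddf0 embQ)) (linear0 F)).
have prE i p : \pi_(Quotient.quot (multiples (a i)))%qT p = 0 <-> a i %| p.
  rewrite -[0](raddf0 (\pi_(Quotient.quot (multiples (a i)))%qT)).
  by rewrite cyclic_pi_eq subr0.
have Psum P : \sum_j zact phi (P j) (u j) = 0 -> forall j, a j %| pZtoQ (P j).
  move=> P0 j; have := Fsum P; rewrite P0 F0 => /ffunP/(_ j).
  by rewrite !ffunE => /esym/prE; rewrite dvdpZr.
have comb1 v : exists2 m, (0 < m)%N &
    exists P, v *+ m = \sum_j zact phi (P j) (u j).
  have /fin_all_exists[r rE] : forall i, exists p, F (embQ v) i =
      \pi_(Quotient.quot (multiples (a i)))%qT p by move=> i; exact: cyclicP.
  have [D D0 [Is IsE]] :=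
    rat_seq_common_denominator [seq (s i)^-1 *: r i | i <- enum I].
  pose P i := Is`_(index i (enum I)).
  have szI : size Is = size (enum I).
    by rewrite -(size_map pZtoQ) IsE !size_map.
  have PE i : s i *: pZtoQ (P i) = D%:~R *: r i.
    have lt : (index i (enum I) < size (enum I))%N.
      by rewrite index_mem mem_enum.
    rewrite /P -(nth_map 0 0 pZtoQ) ?szI // IsE (nth_map 0); last by rewrite size_map.
    rewrite (nth_map i _ _ lt) nth_index ?mem_enum // !scalerA.
    by rewrite mulrAC mulfV // mul1r.
  have : embQ (v *~ D - \sum_j zact phi (P j) (u j)) = 0.
    rewrite raddfB; apply/eqP; rewrite subr_eq0; apply/eqP/FI.
    rewrite Fsum; transitivity (F (D%:~R%:P *: (embQ v : M))).
      congr (F _); rewrite -[RHS]/(polymod_scale _ _) polymod_scaleC scaler_int.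
      exact: (raddfMz embQ).
    rewrite linearZ /=; apply/ffunP => i; rewrite !ffunE rE PE.
    by rewrite -[LHS]/(cyclic_scale _ _) cyclic_scaleE mul_polyC.
  case/embQ_eq0 => m m0 /eqP; rewrite mulrnBl subr_eq0 => /eqP e'.
  exists (`|D| * m)%N; first by rewrite muln_gt0 m0 absz_gt0 D0.
  exists (fun j => (sgz D * m%:Z)%:P * P j).
  transitivity ((v *~ D *+ m) *~ sgz D).
    by rewrite !pmulrn -!mulrzA; congr (_ *~ _); rewrite PoszM abszEsg; ring.
  rewrite e' pmulrn -mulrzA mulrz_suml; apply: eq_bigr => j _.
  by rewrite zactCM [sgz D * _]mulrC.
have comb : exists2 M, (0 < M)%N &
    forall v, exists P, v *+ M = \sum_j zact phi (P j) (u j).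
  have /fin_all_exists2[m m0 mP] := fun i : 'I_k => comb1 (g i).
  exists (\prod_i m i)%N; first exact: prodn_gt0.
  move=> v; have [c ->] := gP v.
  have [P PE] := fin_all_exists mP.
  pose c' i := c i * (\prod_(l | l != i) m l)%N%:Z.
  exists (fun j => \sum_i (c' i)%:P * P i j).
  transitivity (\sum_i (g i *+ m i) *~ c' i).
    rewrite pmulrn mulrz_suml; apply: eq_bigr => i _.
    rewrite pmulrn -!mulrzA; congr (_ *~ _).
    by rewrite /c' (bigD1 i) //= PoszM; move: (Posz _) (Posz _) => x y; ring.
  under [RHS]eq_bigr do rewrite zact_suml.
  rewrite exchange_big /=; apply: eq_bigr => i _; rewrite PE mulrz_suml.
  by apply: eq_bigr => j _; rewrite zactCM.
exists u; split => // j A jA.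
pose P i := if i == j then A else 0.
have -> : zact phi A (u j) = \sum_i zact phi (P i) (u i).
  rewrite (bigD1 j) //= big1 ?addr0 /P ?eqxx // => i ij.
  by rewrite (negPf ij) zact0l.
apply/embQ_eq0/FI.
rewrite Fsum -(raddf0 embQ) F0; apply/ffunP => i; rewrite !ffunE.
apply/prE; rewrite dvdpZr // /P; case: eqP => [->//|_].
by rewrite rmorph0 dvdp0.
Qed.

End RationalGenerators.

(** * Subgroups of the semidirect product *)

Lemma card_eq_finType (T : finType) : ([set: T]%classic #= `I_#|T|)%card.
Proof.
apply: card_eq_trans (card_esym card_II).
pose f (i : 'I_#|T|) := enum_val i.
rewrite (_ : [set: T]%classic = f @` setT)%classic.
  by apply: inj_card_eq => i j _ _; exact: enum_val_inj.
by apply/seteqP; split=> // x _; exists (enum_rank x) => //; rewrite /f enum_rankK.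
Qed.

Section Index.
Local Open Scope classical_set_scope.
Variables (G : groupType) (H : set G).

(** The left cosets of [H] are the fibres of [kappa]. *)
Lemma has_index_card (T : finType) (kappa : G -> T) :
  (forall t, exists x, kappa x = t) ->
  (forall x y, kappa x = kappa y <-> H (x^-1 * y)%g) -> has_index H #|T|.
Proof.
move=> ksurj kP; apply: card_eq_trans (card_eq_finType T).
have cosetE x : [set (x * h)%g | h in H] = [set y | kappa y = kappa x].
  apply/seteqP; split=> [_ [h Hh <-]|y /= /esym/kP Hxy] /=.
    by apply/esym/kP; rewrite mulgA mulVg mul1g.
  by exists (x^-1 * y)%g => //; rewrite mulgA mulgV mul1g.
rewrite (_ : left_cosets H = (fun t => [set y | kappa y = t]) @` setT).
  apply: inj_card_eq => t t' _ _ /= e; have [x xt] := ksurj t.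
  by have := congr1 (fun A : set G => A x) e; rewrite /= xt => <-.
apply/seteqP; split=> [_ [x _ <-]|_ [t _ <-]].
  by exists (kappa x) => //; rewrite cosetE.
by have [x <-] := ksurj t; exists x => //; rewrite cosetE.
Qed.

Lemma has_index_inj n m : has_index H n -> has_index H m -> n = m.
Proof.
move=> hn hm; apply/card_eq_II; exact: card_eq_trans (card_esym hn) hm.
Qed.

End Index.

Section Subgroups.
Variables (N : zmodType) (phi : {additive N -> N}) (phi_bij : bijective phi).
Local Notation G := (sdprodZ phi_bij).
Local Notation pow := (phi_pow phi_bij).
Variable H : set G.

Hypothesis sgH : is_subgroup H.

Lemma sub1 : H (0, 0). Proof. by case: sgH. Qed.

Lemma subM v w m k : H (v, m) -> H (w, k) -> H (v + pow m w, m + k).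
Proof. by case: sgH => _ hM _; exact: hM. Qed.

Lemma subV v m : H (v, m) -> H (- pow (- m) v, - m).
Proof. by case: sgH => _ _ hV; exact: hV. Qed.

Lemma sub0D v w : H (v, 0) -> H (w, 0) -> H (v + w, 0).
Proof. exact: subM. Qed.

Lemma sub0N v : H (v, 0) -> H (- v, 0).
Proof. exact: subV. Qed.

Lemma sub0B v w : H (v, 0) -> H (w, 0) -> H (v - w, 0).
Proof. by move=> Hv /sub0N; exact: sub0D. Qed.

Lemma sub0Mn v n : H (v, 0) -> H (v *+ n, 0).
Proof.
by move=> Hv; elim: n => [|n IH]; rewrite ?mulr0n ?mulrS; [exact: sub1|exact: sub0D].
Qed.

Lemma sub0Mz v c : H (v, 0) -> H (v *~ c, 0).
Proof.
by case: c => n Hv; rewrite ?NegzE ?mulrNz -?pmulrn; do ?apply: sub0N; exact: sub0Mn.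
Qed.

Lemma sub0_sum (I : Type) (r : seq I) (P : pred I) (F : I -> N) :
  (forall i, P i -> H (F i, 0)) -> H (\sum_(i <- r | P i) F i, 0).
Proof. by apply: (big_ind (fun v => H (v, 0))); [exact: sub1|exact: sub0D]. Qed.

(** The quotient of two elements of [G] above the same integer lies in [N]. *)
Lemma sub_fiber v w m : H (w, m) -> H (v, m) <-> H (v - w, 0).
Proof.
move=> Hw; split=> [Hv|Hvw].
  have := subM Hv (subV Hw); rewrite subrr phi_powN -phi_powD subrr.
  exact.
by have := subM Hvw Hw; rewrite add0r subrK.
Qed.

Hypothesis maxH : is_maximal_subgroup H.
Hypothesis HN : ~ forall v, H (v, 0).

(** The preimage in [G] of the image of [H] in [Z] is a subgroup that contains
    both [H] and [N], hence it is [G]. *)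
Lemma maximal_surj m : exists v, H (v, m).
Proof.
have [_ _ maxH'] := maxH; pose K : set G := fun x => exists w, H (w, x.2).
have sgK : is_subgroup K.
  split; first by exists 0; exact: sub1.
    by move=> [v i] [w j] [/= v' Hv] [w' Hw]; exists (v' + pow i w'); exact: subM.
  by move=> [v i] [/= v' Hv]; exists (- pow (- i) v'); exact: subV.
have [[v i] Hvi|KH|KT] := maxH' K sgK; first by exists v.
  by case: HN => v; rewrite -KH; exists 0; exact: sub1.
by have : K (0, m) by rewrite KT.
Qed.

(** Conjugation by an element of [H] above the generator of [Z] preserves
    [H :&: N] and acts on [N] as [phi]. *)
Lemma maximal_phi_stable v : H (v, 0) <-> H (phi v, 0).
Proof.
have [w Hw] := maximal_surj 1; split=> Hv.
  have := subM (subM Hw Hv) (subV Hw).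
  rewrite phi_powN -phi_powD addr0 subrr /=.
  by rewrite addrAC subrr add0r.
have := subM (subM (subV Hw) Hv) Hw.
rewrite addr0 addNr addrAC addNr add0r.
rewrite -[phi v]/(pow 1 v) -phi_powD.
exact.
Qed.

(** If [L] is [phi]-stable and contains [H :&: N] then the product of [L] and
    [H] is a subgroup; by maximality it is [H] or [G]. *)
Lemma maximal_stable_dichotomy (L : N -> Prop) :
  L 0 -> (forall v w, L v -> L w -> L (v - w)) ->
  (forall v, L v <-> L (phi v)) -> (forall v, H (v, 0) -> L v) ->
  (forall v, L v -> H (v, 0)) \/ (forall v, L v).
Proof.
move=> L0 LB Lphi HL; have [_ _ maxH'] := maxH.
have LN v : L v -> L (- v) by rewrite -sub0r; exact: LB.
have LD v w : L v -> L w -> L (v + w) by move=> Lv /LN; rewrite -{2}[w]opprK; exact: LB.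
have Lpow m v : L v -> L (pow m v).
  case: m => k Lv /=; first by elim: k => //= k /Lphi.
  by elim: k => [|k IH]; apply/Lphi; rewrite /= phi_invK.
pose K : set G := fun x => exists2 w, H (w, x.2) & L (x.1 - w).
have sgK : is_subgroup K.
  split; first by exists 0; [exact: sub1|rewrite subr0].
    move=> [v i] [w j] [/= v' Hv Lv] [w' Hw Lw]; exists (v' + pow i w').
      exact: subM.
    by rewrite /= opprD addrACA -phi_powN -phi_pow_is_additive; apply/LD/Lpow.
  move=> [v i] [/= v' Hv Lv]; exists (- pow (- i) v'); first exact: subV.
  by rewrite /= -opprD -phi_powN -phi_pow_is_additive; apply/LN/Lpow.
have [[v i] Hvi|KH|KT] := maxH' K sgK.
- by exists v => //=; rewrite subrr.
- left=> v Lv; rewrite -KH; exists 0; first exact: sub1.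
  by rewrite subr0.
right=> v; have [/= w Hw Lw] : K (v, 0) by rewrite KT.
by rewrite -(subrK w v); apply/LD/HL.
Qed.

End Subgroups.

Lemma infinite_pigeonhole (T : Type) (S : set T) (c : nat -> T) :
  finite_set S -> (forall i, S (c i)) -> exists i j, (i < j)%N /\ c i = c j.
Proof.
move=> finS cS; apply: contrapT => nc; apply: infinite_nat.
have ci : injective c.
  move=> i j cij; case: (ltngtP i j) => // lt; case: nc; first by exists i, j.
  by exists j, i.
apply: card_le_finite finS.
have /card_eqPle[_ le_im] : (c @` setT #= [set: nat])%card.
  by apply: inj_card_eq => i j _ _; exact: ci.
apply: (card_le_trans le_im); apply: subset_card_le.
by move=> _ [i _ <-].
Qed.

(** * The simple quotient attached to a maximal subgroup *)

Section MaximalQuotient.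
Variables (N : zmodType) (phi : {additive N -> N}) (phi_bij : bijective phi).
Local Notation G := (sdprodZ phi_bij).
Local Notation pow := (phi_pow phi_bij).
Variables (H : set G) (n : nat).
Hypotheses (fgN : finitely_generated_zmod N) (maxH : is_maximal_subgroup H)
  (HN : ~ forall v, H (v, 0)) (Hn : has_index H n).

Let sgH : is_subgroup H. Proof. by case: maxH. Qed.
Let phi_surj w : exists v, w = phi v.
Proof. by have [v /eqP <-] := bij_surj phi_bij w; exists v. Qed.

(** Two multiples of [v] lie in the same coset of [H], since the index is
    finite. *)
Lemma maximal_torsion v : exists2 m, (0 < m)%N & H (v *+ m, 0).
Proof.
pose c i := [set (sdprodZ_base phi_bij (v *+ i) * h)%g | h in H]%classic.
have [||i [j [lt]]] := @infinite_pigeonhole _ (left_cosets H) c.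
- by apply/finite_setP; exists n.
- by move=> i; exists (sdprodZ_base phi_bij (v *+ i)).
move=> cij; exists (j - i)%N; first by rewrite subn_gt0.
have : c j (v *+ j, 0) by exists 1%g; [exact: sub1|rewrite mulg1].
rewrite -cij => -[[w k] Hw [e1 e2]].
rewrite add0r in e2; rewrite e2 /= in Hw e1.
by rewrite mulrnBr 1?ltnW // -e1 addrAC subrr add0r.
Qed.

Lemma maximal_uniform_torsion : exists2 m, (0 < m)%N & forall v, H (v *+ m, 0).
Proof.
have [k [g gP]] := fgN.
have /fin_all_exists2[m m0 mP] := fun i : 'I_k => maximal_torsion (g i).
exists (\prod_i m i)%N; first exact: prodn_gt0.
move=> v; have [c ->] := gP v; rewrite -sumrMnl; apply: sub0_sum => // i _.
rewrite (bigD1 i) //= mulrnA pmulrn; apply: sub0Mz => //.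
by rewrite !pmulrn mulrzAC -pmulrn; apply: sub0Mz.
Qed.

(** For every prime [p] the subgroup [p N + H :&: N] is [H :&: N] or [N].  If it
    were [N] for all [p], then also [m N + H :&: N] would be [N] for all
    [m > 0], whereas some [m N] lies in [H]. *)
Lemma maximal_prime_torsion : exists2 p, prime p & forall v, H (v *+ p, 0).
Proof.
have dich p : prime p -> (forall v, H (v *+ p, 0)) \/
    (forall v, exists w, H (v - w *+ p, 0)).
  move=> p_pr; pose L v := exists w, H (v - w *+ p, 0).
  have [] := @maximal_stable_dichotomy _ _ _ _ sgH maxH L.
  - by exists 0; rewrite mul0rn subrr; exact: sub1.
  - move=> v w [v' Hv] [w' Hw]; exists (v' - w').
    rewrite (_ : _ - _ = (v - v' *+ p) - (w - w' *+ p)); first exact: sub0B.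
    rewrite mulrnBl !opprB [w' *+ p - w]addrC [RHS]addrACA.
    by rewrite [- _ + w' *+ p]addrC.
  - move=> v; split=> [[w Hw]|[w']].
      by exists (phi w); rewrite -raddfMn -raddfB; apply: (maximal_phi_stable sgH maxH HN _).1.
    have [w ->] := phi_surj w'; rewrite -raddfMn -raddfB => Hw.
    by exists w; apply: (maximal_phi_stable sgH maxH HN _).2.
  - by move=> v Hv; exists 0; rewrite mul0rn subr0.
  - by move=> Lp; left=> v; apply: Lp; exists v; rewrite subrr; exact: sub1.
  - by right.
apply: contrapT => np; case: HN => v.
have div m : (0 < m)%N -> forall v, exists w, H (v - w *+ m, 0).
  elim/ltn_ind: m => m IH m0 {}v; have [m1|m1] := leqP m 1.
    exists v; have -> : m = 1%N by lia.
    by rewrite subrr; exact: sub1.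
  have p_pr := pdiv_prime m1; have dm := pdiv_dvd m.
  have [pH|pL] := dich _ p_pr; first by case: np; exists (pdiv m).
  have [||w Hw] := IH (m %/ pdiv m)%N _ _ v.
  - by rewrite ltn_Pdiv // prime_gt1.
  - by rewrite divn_gt0 ?pdiv_gt0 // dvdn_leq.
  have [w' Hw'] := pL w; exists w'.
  have := sub0D sgH Hw (sub0Mn sgH (m %/ pdiv m) Hw').
  by rewrite mulrnBl addrA subrK -mulrnA mulnC divnK.
have [m m0 mH] := maximal_uniform_torsion.
have [w Hw] := div m m0 v.
by rewrite -(subrK (w *+ m) v); apply: sub0D.
Qed.

End MaximalQuotient.

Section Coordinates.
Variables (N : zmodType) (p : nat) (L : N -> Prop).
Hypotheses (p_pr : prime p) (L0 : L 0)
  (LB : forall v w, L v -> L w -> L (v - w)) (Lp : forall v, L (v *+ p)).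

Let LN v : L v -> L (- v). Proof. by rewrite -sub0r; exact: LB. Qed.
Let LD v w : L v -> L w -> L (v + w).
Proof. by move=> Lv /LN; rewrite -{2}[w]opprK; exact: LB. Qed.
Let LMz v c : L v -> L (v *~ c).
Proof.
have LMn m : L v -> L (v *+ m).
  by move=> Lv; elim: m => [|m IH]; rewrite ?mulr0n ?mulrS; [|exact: LD].
by case: c => m; rewrite ?NegzE ?mulrNz -?pmulrn => /LMn // h; exact: LN.
Qed.
Let L_sum (I : Type) (r : seq I) (F : I -> N) :
  (forall i, L (F i)) -> L (\sum_(i <- r) F i).
Proof. by move=> LF; apply: (big_ind L). Qed.

Lemma Fp_natK (x : 'F_p) : (x : nat)%:R = x.
Proof. by rewrite natr_Zp. Qed.

Lemma Fp_intK (x : 'F_p) : (Posz x)%:~R = x.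
Proof. by rewrite -pmulrn Fp_natK. Qed.

Lemma quotient_mulrz_congr v (c d : int) :
  c%:~R = d%:~R :> 'F_p -> L (v *~ c - v *~ d).
Proof.
move/eqP; rewrite -subr_eq0 -rmorphB /= intr_Fp_eq0 // -mulrzBr => pcd.
have /dvdzP[t ->] : (p%:Z %| c - d)%Z by rewrite dvdzE.
by rewrite mulrC mulrzA; apply: LMz; exact: Lp.
Qed.

(** A quotient of [N] killed by [p] is a quotient of the space of coefficient
    rows on finitely many generators, by a subspace [B]; the cokernel of [B]
    gives coordinates on it. *)
Lemma quotient_coordinates : finitely_generated_zmod N ->
  exists r (q : {additive N -> 'rV['F_p]_r}),
    (forall y, exists v, q v = y) /\ forall v, L v <-> q v = 0.
Proof.
move=> [K [g gP]].
pose lift (x : 'rV['F_p]_K) := \sum_i g i *+ x 0 i.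
(* [x] represents the class of [v]. *)
pose rep v x := L (v - lift x).
have rep_int (c : 'I_K -> int) : rep (\sum_i g i *~ c i) (\row_i (c i)%:~R).
  rewrite /rep -sumrB; apply: L_sum => i; rewrite mxE pmulrn.
  by apply: quotient_mulrz_congr; rewrite Fp_intK.
have rep_ex v : exists x, rep v x by have [c ->] := gP v; eexists; exact: rep_int.
have rep_comb v w x y a : rep v x -> rep w y -> rep (v + w *~ a) (x + a%:~R *: y).
  move=> vx wy; rewrite /rep.
  have -> : v + w *~ a - lift (x + a%:~R *: y) =
      (v - lift x) + (w - lift y) *~ a + (lift x + lift y *~ a - lift (x + a%:~R *: y)).
    rewrite mulrzBl [X in _ = X + _]addrACA -opprD [RHS]addrA; congr (_ - _).
    by rewrite subrK.
  apply: LD; first by apply: LD => //; exact: LMz.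
  rewrite /lift mulrz_suml -big_split -sumrB; apply: L_sum => i /=.
  rewrite !mxE !pmulrn -mulrzA -mulrzDr; apply: quotient_mulrz_congr.
  by rewrite [RHS]Fp_intK rmorphD rmorphM /= !Fp_intK mulrC.
pose L' (x : 'rV['F_p]_K) := `[< rep 0 x >].
have repL v x : rep v x -> L v <-> L' x.
  move=> vx; split=> [Lv|/asboolP Lx].
    apply/asboolP; rewrite /rep (_ : 0 - _ = v - lift x - v); last by rewrite addrAC subrr.
    exact: LB.
  rewrite -(subrK (lift x) v); apply: LD => //.
  by rewrite -[lift x]opprK; apply: LN; rewrite -sub0r.
have L'0 : L' 0.
  by apply/asboolP; rewrite /rep /lift big1 ?subr0 // => i _; rewrite mxE.
have L'D x y (a : 'F_p) : L' x -> L' y -> L' (x + a *: y).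
  move=> /asboolP Lx /asboolP Ly; apply/asboolP.
  by have := rep_comb 0 0 x y (Posz a) Lx Ly; rewrite mul0rz addr0 Fp_intK.
pose B := (\sum_(x | L' x) <<x>>)%MS.
have BP x : (x <= B)%MS = L' x.
  apply/idP/idP => [/sub_sumsmxP[u ->]|Lx]; last first.
    by apply: (sumsmx_sup x) => //; rewrite genmxE.
  apply: (big_ind L') => // [y z Ly Lz|y Ly].
    by rewrite -[z]scale1r; exact: L'D.
  have /sub_rVP[a ->] : (u y *m <<y>> <= y)%MS by rewrite mulmx_sub ?genmxE.
  by rewrite -[X in L' X]add0r; exact: L'D.
pose C := cokermx B; exists (\rank C).
have /choice[x xP] := rep_ex.
pose q v := x v *m col_base C.
have kerP y : y *m col_base C = 0 <-> L' y.
  rewrite -BP submxE -/C -[X in _ *m X == 0](mulmx_base C) mulmxA; split=> [->|].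
    by rewrite mul0mx.
  by rewrite mulmx_free_eq0 ?row_base_free // => /eqP.
have qE v y : rep v y -> q v = y *m col_base C.
  move=> vy; apply/eqP; rewrite -subr_eq0 -mulmxBl; apply/eqP/kerP/(repL 0).
    have := rep_comb _ _ _ _ (-1) (xP v) vy.
    by rewrite mulrN1z subrr rmorphN1 scaleN1r.
  exact: L0.
have qD : zmod_morphism q.
  move=> v w; rewrite /q -mulmxBl; apply: qE.
  have := rep_comb _ _ _ _ (-1) (xP v) (xP w).
  by rewrite mulrN1z rmorphN1 scaleN1r.
pose qA := GRing.isZmodMorphism.Build _ _ q qD.
pose qadd : {additive N -> 'rV['F_p]_(\rank C)} := HB.pack q qA.
exists qadd; split=> [y|v].
  have /submxP[z ->] : (y <= col_base C)%MS by rewrite submx_full ?col_base_full.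
  exists (lift z); apply: qE; rewrite /rep subrr; exact: L0.
by rewrite (repL _ _ (xP v)) -kerP.
Qed.

Lemma quotient_endomorphism r (q : {additive N -> 'rV['F_p]_r})
    (phi : {additive N -> N}) :
  (forall y, exists v, q v = y) -> (forall v, L v <-> q v = 0) ->
  (forall v, L v -> L (phi v)) ->
  exists Q : 'M_r, forall v, q (phi v) = q v *m Q.
Proof.
move=> qsurj qP Lphi.
have /choice[e eP] := fun i : 'I_r => qsurj (delta_mx 0 i).
exists (\matrix_i q (phi (e i))) => v.
have qMn w m : q (w *+ m) = m%:R *: q w by rewrite raddfMn scaler_nat.
have : L (v - \sum_i e i *+ q v 0 i).
  apply/qP; rewrite raddfB raddf_sum [X in X - _]row_sum_delta; apply/eqP.
  rewrite subr_eq0; apply/eqP/eq_bigr => i _.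
  by rewrite qMn eP Fp_natK.
move=> /Lphi/qP/eqP; rewrite !raddfB subr_eq0 => /eqP ->.
rewrite !raddf_sum mulmx_sum_row; apply: eq_bigr => i _.
by rewrite rowK raddfMn qMn Fp_natK.
Qed.

End Coordinates.

(** The surjection [q] with kernel [L] identifies the quotient [N / L] with an
    irreducible [F_p[x]]-module, where [x] acts by right multiplication by
    [Q]. *)
Definition simple_quotient (N : zmodType) (phi : N -> N) (L : N -> Prop) p k
    (q : {additive N -> 'rV['F_p]_k.+1}) (Q : 'M['F_p]_k.+1) : Prop :=
  [/\ forall y, exists v, q v = y,
      forall v, L v <-> q v = 0,
      forall v, q (phi v) = q v *m Q &
      forall U : 'M_k.+1, (U *m Q <= U)%MS -> U = 0 \/ row_full U].

Section Structure.
Variables (N : zmodType) (phi : {additive N -> N}) (phi_bij : bijective phi).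
Local Notation G := (sdprodZ phi_bij).
Local Notation pow := (phi_pow phi_bij).
Variables (H : set G) (n : nat).
Hypotheses (fgN : finitely_generated_zmod N) (maxH : is_maximal_subgroup H)
  (HN : ~ forall v, H (v, 0)) (Hn : has_index H n).

Let sgH : is_subgroup H. Proof. by case: maxH. Qed.

Lemma maximal_phi_pow_stable m v : H (v, 0) <-> H (pow m v, 0).
Proof.
have Hpow k w : H (w, 0) -> H (pow k w, 0).
  case: k => k Hw /=; first by elim: k => //= k /(maximal_phi_stable sgH maxH HN _).1.
  by elim: k => [|k IH]; apply: (maximal_phi_stable sgH maxH HN _).2; rewrite /= phi_invK.
split=> [|/(Hpow (- m))]; first exact: Hpow.
by rewrite -phi_powD addNr.
Qed.

(** The cosets of [H] in [G] correspond to those of [H :&: N] in [N], because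
    [H] maps onto [Z]. *)
Lemma quotient_index p r (q : {additive N -> 'rV['F_p]_r}) : prime p ->
  (forall y, exists v, q v = y) -> (forall v, H (v, 0) <-> q v = 0) ->
  n = (p ^ r)%N.
Proof.
move=> p_pr qsurj qP.
have /choice[w wP] := maximal_surj sgH maxH HN.
(* The element [(w m, m)] of [H] moves [(v, m)] into [N] within its coset. *)
pose kappa (x : G) := q (x.1 - w x.2).
suff: has_index H #|{:'rV['F_p]_r}|.
  by move=> /(has_index_inj Hn) ->; rewrite card_mx card_Fp // mul1n.
apply: (@has_index_card _ _ _ kappa) => [y|[v m] [v' m']].
  have [v vy] := qsurj y; exists (v, 0); rewrite /kappa /= raddfB vy.
  by have /qP -> := wP 0; rewrite subr0.
rewrite -[(_ * _)%g]/(- pow (- m) v + pow (- m) v', - m + m').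
have Hw : H (- pow (- m) (w m) + pow (- m) (w m'), - m + m').
  exact: (subM sgH (subV sgH (wP m)) (wP m')).
rewrite (sub_fiber sgH _ Hw) -!phi_powN -!phi_pow_is_additive -phi_powN.
rewrite -phi_pow_is_additive -maximal_phi_pow_stable qP opprD opprK addrACA raddfD /=.
rewrite [- v + w m]addrC -opprB raddfN /=.
rewrite -[kappa (v, m)]/(q (v - w m)) -[kappa (v', m')]/(q (v' - w m')).
split=> [->|/eqP]; first by rewrite addNr.
by rewrite addr_eq0 => /eqP /oppr_inj.
Qed.

(** [Q] is irreducible because the preimage in [N] of a subspace stable by [Q]
    is stable by [phi] and contains [H :&: N]. *)
Lemma maximal_simple_quotient :
  exists p k (q : {additive N -> 'rV['F_p]_k.+1}) (Q : 'M['F_p]_k.+1),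
    [/\ prime p, n = (p ^ k.+1)%N &
        simple_quotient phi (fun v => H (v, 0)) q Q].
Proof.
have [p p_pr pH] := maximal_prime_torsion fgN maxH HN Hn.
have [r [q [qsurj qP]]] :=
  quotient_coordinates p_pr (sub1 sgH) (fun v w => @sub0B _ _ _ _ sgH v w) pH fgN.
have [Q QP] := quotient_endomorphism qsurj qP
  (fun v => (maximal_phi_stable sgH maxH HN v).1).
have nE := quotient_index p_pr qsurj qP.
case: r q Q qsurj qP QP nE => [|k] q Q qsurj qP QP nE.
  by case: HN => v; apply/qP; rewrite [q v]thinmx0.
exists p, k, q, Q; split=> //; split=> // U UQ.
have unitQ : Q \in unitmx.
  rewrite -row_full_unit -sub1mx; apply/row_subP => i.
  have [v vE] := qsurj (row i 1%:M).
  have [w /eqP wv] := bij_surj phi_bij v.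
  by rewrite -vE -wv QP submxMl.
have UQU : (U <= U *m Q)%MS.
  by rewrite -(geq_leqif (mxrank_leqif_sup UQ)) mxrankMfree // row_free_unit.
have [] := maximal_stable_dichotomy sgH maxH (L := fun v => (q v <= U)%MS).
- by rewrite raddf0 sub0mx.
- by move=> v w vU wU; rewrite raddfB addmx_sub // eqmx_opp.
- move=> v; rewrite QP; split=> [vU|vU].
    exact: submx_trans (submxMr _ vU) UQ.
  by have := submxMr (invmx Q) (submx_trans vU UQU); rewrite !mulmxK.
- by move=> v /qP ->; rewrite sub0mx.
- move=> UH; left; apply/eqP; rewrite -submx0; apply/row_subP => i.
  have [v vE] := qsurj (row i U).
  by rewrite -vE submx0; apply/eqP/qP/UH; rewrite vE row_sub.
move=> UT; right; rewrite -sub1mx; apply/row_subP => i.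
by have [v <-] := qsurj (row i 1%:M).
Qed.

End Structure.

(** * Irreducible matrices *)

Lemma horner_mxE (R : comNzRingType) k (Q : 'M[R]_k.+1) (P : {poly R}) s :
  (size P <= s)%N ->
  horner_mx Q P = \sum_(i < s) P`_i *: Q ^+ i.
Proof.
move=> le; rewrite -{1}[P]coefK poly_def rmorph_sum /=.
rewrite (big_ord_widen s (fun i => horner_mx Q (P`_i *: 'X^i)) le) big_mkcond /=.
apply: eq_bigr => i _; rewrite horner_mxZ rmorphXn /= horner_mx_X.
by case: ltnP => // h; rewrite nth_default // scale0r.
Qed.

Section IrreducibleMatrix.
Variables (F : fieldType) (k : nat) (Q : 'M[F]_k.+1).

Lemma horner_mx_modp (f P : {poly F}) : horner_mx Q f = 0 ->
  horner_mx Q (P %% f) = horner_mx Q P.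
Proof.
by move=> f0; rewrite [in RHS](divp_eq P f) rmorphD rmorphM /= f0 mulr0 add0r.
Qed.

Hypothesis irrQ : forall U : 'M_k.+1, (U *m Q <= U)%MS -> U = 0 \/ row_full U.

(** The powers of [Q] of exponent less than the degree of [r] span a stable
    subspace when applied to a vector, by division by [r]. *)
Lemma irreducible_annihilator_size (r : {poly F}) :
  r != 0 -> horner_mx Q r = 0 -> (k.+1 < size r)%N.
Proof.
move=> r0 rQ; pose s := (size r).-1.
have szr : size r = s.+1 by rewrite prednK // size_poly_gt0.
pose e : 'rV[F]_k.+1 := delta_mx 0 0.
have e0 : e != 0 by apply/eqP => /matrixP/(_ 0 0)/eqP; rewrite !mxE !eqxx oner_eq0.
pose U := \matrix_(i < s) (e *m Q ^+ i).
have inU P : (e *m horner_mx Q P <= U)%MS.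
  rewrite -(horner_mx_modp P rQ) (@horner_mxE _ _ _ _ s); last first.
    by rewrite -ltnS -szr ltn_modp.
  rewrite mulmx_sumr summx_sub // => i _; rewrite -scalemxAr scalemx_sub //.
  by rewrite (_ : e *m _ = row i U) ?row_sub // rowK.
rewrite szr ltnS.
have [] := irrQ (U := <<U>>%MS).
- rewrite genmxE (eqmxMr _ (genmxE _)); apply/row_subP => i.
  rewrite row_mul rowK -mulmxA.
  by have := inU ('X^i * 'X); rewrite rmorphM rmorphXn /= horner_mx_X.
- move=> U0; have := inU 1; rewrite -(genmxE U) U0.
  by rewrite rmorph1 mulmx1 submx0 (negPf e0).
by rewrite /row_full genmxE => /eqP <-; exact: rank_leq_row.
Qed.

(** If [g * e] is the characteristic polynomial then [g] or [e] vanishes at [Q]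
    according to whether the kernel of [g] at [Q] is everything or 0, so that
    its degree is that of the characteristic polynomial. *)
Lemma irreducible_char_poly : irreducible_poly (char_poly Q).
Proof.
split=> [|g szg gf]; first by rewrite size_char_poly.
have f0 := monic_neq0 (char_poly_monic Q).
have [e eg] := dvdpP _ _ gf.
have e0 : e != 0 by apply: contraNneq f0 => e0; rewrite eg e0 mul0r.
have g0 : g != 0 by apply: contraNneq f0 => g0; rewrite eg g0 mulr0.
have szeg : (size e + size g = k.+3)%N.
  have := size_char_poly Q; rewrite eg size_mul //.
  by move: e0 g0; rewrite -!size_poly_gt0; move: (size e) (size g) => x y; clear; lia.
have comm : horner_mx Q g *m Q = Q *m horner_mx Q g.
  by have := comm_horner_mx2 Q g 'X; rewrite horner_mx_X.
have [] := irrQ (U := kermx (horner_mx Q g)).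
- by apply/sub_kermxP; rewrite -mulmxA -comm mulmxA mulmx_ker mul0mx.
- move=> /eqP; rewrite -mxrank_eq0 mxrank_ker subn_eq0 => full.
  have ug : horner_mx Q g \in unitmx by rewrite -row_free_unit -row_leq_rank.
  have : horner_mx Q e = 0.
    have := Cayley_Hamilton Q; rewrite eg rmorphM => eg0.
    by apply: (can_inj (mulmxK ug)); rewrite mul0mx.
  move=> /(irreducible_annihilator_size e0); move: szg szeg g0.
  by rewrite -size_poly_gt0; move: (size e) (size g) => x y /eqP; clear; lia.
move=> full; have : horner_mx Q g = 0.
  by have /sub_kermxP := submx_full (1%:M : 'M_k.+1) full; rewrite mul1mx.
move=> /(irreducible_annihilator_size g0) sg.
rewrite -dvdp_size_eqp // size_char_poly eqn_leq.
rewrite sg andbT; have := dvdp_leq f0 gf; rewrite size_char_poly => h; exact: h.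
Qed.

Lemma horner_mx_coprime_unit (P : {poly F}) :
  ~~ (char_poly Q %| P) -> horner_mx Q P \in unitmx.
Proof.
rewrite -(irreducible_poly_coprime _ irreducible_char_poly).
move=> /Bezout_eq1_coprimepP[[u v] /= /(congr1 (horner_mx Q))].
rewrite rmorphD !rmorphM /= Cayley_Hamilton mulr0 add0r rmorph1 => e.
by have [] := mulmx1_unit e.
Qed.

(** The vectors [w] that are orthogonal to all the [Q ^+ i *m b] form a stable
    subspace, which is proper when [b] is nonzero. *)
Lemma irreducible_cyclic_dual (b : 'cV_k.+1) (w : 'rV_k.+1) : b != 0 ->
  (forall i : 'I_k.+1, w *m Q ^+ i *m b = 0) -> w = 0.
Proof.
move=> b0 wb; pose M := \matrix_(j < k.+1, i < k.+1) (Q ^+ i *m b) j 0.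
have inM (v : 'rV_k.+1) : v *m M = 0 <-> forall P, v *m horner_mx Q P *m b = 0.
  have colM i : v *m M *m delta_mx i 0 = v *m Q ^+ i *m b.
    rewrite -!mulmxA; congr (_ *m _); rewrite -colE.
    by apply/matrixP => x y; rewrite !mxE ord1.
  split=> [vM P|vP].
    rewrite -(horner_mx_modp P (Cayley_Hamilton Q)) (@horner_mxE _ _ _ _ k.+1); last first.
      have := ltn_modpN0 P (monic_neq0 (char_poly_monic Q)).
      by rewrite size_char_poly ltnS.
    rewrite mulmx_sumr mulmx_suml big1 // => i _.
    by rewrite -scalemxAr -scalemxAl -colM vM mul0mx scaler0.
  apply/matrixP => x i; have := colM i; rewrite -colE.
  have := vP 'X^i; rewrite rmorphXn /= horner_mx_X => -> /matrixP/(_ x 0).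
  by rewrite !mxE.
have wM : w *m M = 0.
  apply/matrixP => x i; have := wb i; rewrite -mulmxA => /matrixP/(_ x 0).
  rewrite !mxE => e; rewrite -[RHS]e; apply: eq_bigr => j _.
  by rewrite !mxE.
have [] := irrQ (U := kermx M).
- apply/row_subP => i; rewrite row_mul; apply/sub_kermxP/inM => P.
  have /inM/(_ ('X * P)) : row i (kermx M) *m M = 0.
    by rewrite -row_mul mulmx_ker row0.
  by rewrite rmorphM /= horner_mx_X !mulmxA.
- by move=> K0; have /sub_kermxP := wM; rewrite K0 submx0 => /eqP.
move=> full; have /sub_kermxP : ((1%:M : 'M_k.+1) <= kermx M)%MS by rewrite submx_full.
rewrite mul1mx => M0; case/eqP: b0; apply/matrixP => j x.
have /matrixP/(_ j 0) := M0; rewrite mxE expr0 mul1mx ord1 => ->.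
by rewrite !mxE.
Qed.

End IrreducibleMatrix.

(** * Upper bound *)

(** [H] and [H'] have common elements above the generator of [Z], hence above
    every integer, and the fibres are cosets of the intersection with [N]. *)
Lemma subgroup_eq_from_fibers (N : zmodType) (phi : {additive N -> N})
    (phi_bij : bijective phi) (H H' : set (sdprodZ phi_bij)) v v' :
  is_subgroup H -> is_subgroup H' -> (forall w, H (w, 0) <-> H' (w, 0)) ->
  H (v, 1) -> H' (v', 1) -> H (v - v', 0) -> H = H'.
Proof.
move=> sgH sgH' H0 Hv H'v' Hvv'.
have H'v : H' (v, 1).
  by have := subM sgH' ((H0 _).1 Hvv') H'v'; rewrite add0r /= subrK.
have common m : exists w, H (w, m) /\ H' (w, m).
  have common_nat (i : nat) : exists w, H (w, i%:Z) /\ H' (w, i%:Z).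
    elim: i => [|i [w [Hw H'w]]]; first by exists 0; split; exact: sub1.
    exists (w + phi_pow phi_bij i%:Z v).
    by rewrite -addn1 PoszD; split; exact: subM.
  case: m => i; first exact: common_nat.
  have [w [Hw H'w]] := common_nat i.+1.
  by eexists; split; [exact: (subV sgH Hw)|exact: (subV sgH' H'w)].
apply/seteqP; split=> -[w m]; have [w' [Hw' H'w']] := common m.
  by move=> /(sub_fiber sgH _ Hw')/H0/(sub_fiber sgH' _ H'w').
by move=> /(sub_fiber sgH' _ H'w')/H0/(sub_fiber sgH _ Hw').
Qed.

Lemma polymod_scale_mulmx (F : fieldType) k (Q : 'M[F]_k.+1) P (v : 'rV_k.+1) :
  @polymod_scale _ _ (mulmxr Q) P v = v *m horner_mx Q P.
Proof.
have itE i : iter i (mulmxr Q) v = v *m Q ^+ i.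
  by elim: i => [|i /= ->]; rewrite ?expr0 ?mulmx1 // exprSr mulmxA.
rewrite /polymod_scale (horner_mxE _ (leqnn _)) mulmx_sumr.
by apply: eq_bigr => i _; rewrite itE scalemxAr.
Qed.

(** Cayley-Hamilton for a lift of [phi] to an integer matrix. *)
Lemma integral_annihilator (N : zmodType) (phi : {additive N -> N}) :
  finitely_generated_zmod N ->
  exists2 chi : {poly int}, chi \is monic & forall v, zact phi chi v = 0.
Proof.
move=> [[|K] [g gP]].
  exists 1; first exact: monic1.
  by move=> v; rewrite zact1; have [c ->] := gP v; rewrite big_ord0.
have /choice[c cP] := fun i => gP (phi (g i)).
pose P := \matrix_(i < K.+1, j < K.+1) c i j.
pose pi (x : 'rV[int]_K.+1) := \sum_i g i *~ x 0 i.
have piD x y : pi (x + y) = pi x + pi y.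
  by rewrite /pi -big_split; apply: eq_bigr => i _; rewrite mxE mulrzDr.
have piZ a x : pi (a *: x) = pi x *~ a.
  by rewrite /pi mulrz_suml; apply: eq_bigr => i _; rewrite mxE mulrC mulrzA.
have phi_pi x : phi (pi x) = pi (x *m P).
  rewrite /pi raddf_sum /=.
  under eq_bigr do rewrite raddfMz cP mulrz_suml.
  rewrite exchange_big /=; apply: eq_bigr => j _.
  rewrite mxE mulrz_sumr; apply: eq_bigr => i _.
  by rewrite mxE mulrC mulrzA.
have iter_pi i x : iter i phi (pi x) = pi (x *m P ^+ i).
  by elim: i => [|i /= ->]; rewrite ?expr0 ?mulmx1 // phi_pi exprSr mulmxA.
exists (char_poly P); first exact: char_poly_monic.
move=> v; have [x ->] : exists x, v = pi x.
  have [x ->] := gP v; exists (\row_i x i).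
  by apply: eq_bigr => i _; rewrite mxE.
have pi0 : pi 0 = 0 by rewrite -(scale0r (0 : 'rV_K.+1)) piZ mulr0z.
transitivity (pi (x *m horner_mx P (char_poly P))); last first.
  by rewrite Cayley_Hamilton mulmx0.
rewrite (horner_mxE _ (leqnn _)) mulmx_sumr (big_morph pi piD pi0) /zact /polymod_scale.
by apply: eq_bigr => i _; rewrite -scalemxAr piZ -iter_pi.
Qed.

Section SimpleQuotientFunctionals.
Variables (N : zmodType) (phi : {additive N -> N}) (p k : nat).
Hypothesis p_pr : prime p.
Local Notation rowF := ('rV['F_p]_k.+1).

Lemma simple_quotient_zact L (q : {additive N -> rowF}) Q P v :
  simple_quotient phi L q Q ->
  q (zact phi P v) = q v *m horner_mx Q (map_poly intr P).
Proof.
move=> [_ _ qphi _]; rewrite -polymod_scale_mulmx.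
exact: (zact_morph (T := mulmxr Q)).
Qed.

Lemma simple_quotient_iter L (q : {additive N -> rowF}) Q i v :
  simple_quotient phi L q Q -> q (iter i phi v) = q v *m Q ^+ i.
Proof.
move=> [_ _ qphi _]; elim: i => [|i /= IH]; first by rewrite expr0 mulmx1.
by rewrite qphi IH exprSr mulmxA.
Qed.

(** The characteristic polynomial kills the functional [v |-> q v *m b] for the
    action of [phi], so its values on the orbit of [u j] follow from the first
    [k.+1] of them by Euclidean division; the orbits of the [u j] span [N] up to
    the integer [M], which is invertible modulo [p]. *)
Lemma simple_quotient_functional_inj (I : finType) (u : I -> N) M L L'
    (q q' : {additive N -> rowF}) Q Q' (b b' : 'cV_k.+1) :
  ~~ (p %| M)%N ->
  (forall v, exists P, v *+ M = \sum_j zact phi (P j) (u j)) ->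
  simple_quotient phi L q Q -> simple_quotient phi L' q' Q' ->
  char_poly Q = char_poly Q' ->
  (forall j (i : 'I_k.+1), q (u j) *m Q ^+ i *m b = q' (u j) *m Q' ^+ i *m b') ->
  forall v, q v *m b = q' v *m b'.
Proof.
move=> pM gen qQ qQ' eqf eqc v.
have M0 : M%:R != 0 :> 'F_p by rewrite pmulrn intr_Fp_eq0.
have [P PE] := gen v.
have reduce (q0 : {additive N -> rowF}) L0 Q0 b0 : simple_quotient phi L0 q0 Q0 ->
    char_poly Q0 = char_poly Q -> M%:R *: (q0 v *m b0) =
    \sum_j \sum_(i < k.+1) (map_poly intr (P j) %% char_poly Q)`_i *:
       (q0 (u j) *m Q0 ^+ i *m b0).
  move=> qQ0 f0; rewrite scalemxAl scaler_nat -raddfMn PE raddf_sum mulmx_suml.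
  apply: eq_bigr => j _; rewrite (simple_quotient_zact _ _ qQ0).
  rewrite -(horner_mx_modp _ (Cayley_Hamilton Q0)) f0.
  rewrite (@horner_mxE _ _ _ _ k.+1); last first.
    have := ltn_modpN0 (map_poly intr (P j)) (monic_neq0 (char_poly_monic Q)).
    by rewrite size_char_poly ltnS.
  rewrite mulmx_sumr mulmx_suml; apply: eq_bigr => i _.
  by rewrite -scalemxAr -scalemxAl.
apply: (scalerI M0); rewrite (reduce _ _ _ _ b qQ erefl).
rewrite (reduce _ _ _ _ b' qQ' (esym eqf)); apply: eq_bigr => j _.
by apply: eq_bigr => i _; congr (_ *: _); exact: eqc.
Qed.

(** [A] acts on the simple quotient by an invertible matrix unless it is
    divisible by the characteristic polynomial of [Q]. *)
Lemma simple_quotient_torsion L (q : {additive N -> rowF}) Q A u m :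
  ~~ (p %| m)%N -> simple_quotient phi L q Q -> zact phi A u *+ m = 0 ->
  ~~ (char_poly Q %| map_poly intr A) -> q u = 0.
Proof.
move=> pm qQ Au nfA; have [_ _ _ irrQ] := qQ.
have m0 : m%:R != 0 :> 'F_p by rewrite pmulrn intr_Fp_eq0.
have := congr1 q Au; rewrite raddf0 raddfMn (simple_quotient_zact _ _ qQ).
rewrite -scaler_nat => /eqP; rewrite scaler_eq0 (negPf m0) /= => /eqP qu0.
apply: (can_inj (mulmxK (horner_mx_coprime_unit irrQ nfA))).
by rewrite mul0mx.
Qed.

(** A single nonzero functional on the simple quotient determines the kernel
    [L]. *)
Lemma simple_quotient_kernel L (q : {additive N -> rowF}) Q (b : 'cV_k.+1) v :
  simple_quotient phi L q Q -> b != 0 ->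
  L v <-> forall i : 'I_k.+1, q (iter i phi v) *m b = 0.
Proof.
move=> qQ b0; have [_ qP _ irrQ] := qQ.
rewrite qP; split=> [qv i|qv].
  by rewrite (simple_quotient_iter _ _ qQ) qv !mul0mx.
by apply: (irreducible_cyclic_dual irrQ b0) => i; rewrite -(simple_quotient_iter _ _ qQ).
Qed.

End SimpleQuotientFunctionals.

(** The monic irreducible factors of [P] of degree [k.+1], as coefficient rows
    so that they live in a finite type. *)
Definition irreducible_rows (F : finFieldType) k (P : {poly F}) :
    {set 'rV[F]_k.+2} :=
  [set x | [&& `[< irreducible_poly (rVpoly x) >],
      rVpoly x \is monic, size (rVpoly x) == k.+2 & rVpoly x %| P]]%SET.

Lemma card_irreducible_rows (F : finFieldType) k (P : {poly F}) : P != 0 ->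
  (#|irreducible_rows k P| <= (size P).-1)%N.
Proof.
move=> P0; rewrite cardE -(size_map (@rVpoly F k.+2)).
apply: (@size_irreducible_factors _ k.+1) => //.
  by rewrite map_inj_uniq ?enum_uniq //; exact: can_inj rVpolyK.
move=> _ /mapP[x + ->].
by rewrite mem_enum inE => /and4P[/asboolP irr mon /eqP sz dvd].
Qed.

Lemma card_nonzero (T : finZmodType) : #|[set x : T | x != 0]%SET| = #|T|.-1.
Proof. by rewrite -(cardsC1 0); apply: eq_card => x; rewrite !inE. Qed.

Lemma card_nonzero_row0 (F : finFieldType) d k :
  (#|[set m : 'M[F]_(d.+1, k) | ((m != 0) && (row 0 m == 0))%R]%SET| <=
     (#|F| ^ (d * k)).-1)%N.
Proof.
rewrite -card_mx -card_nonzero.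
rewrite -(@card_in_imset _ _ (row' ord0)) => [|m m']; last first.
  rewrite !inE => /andP[_ /eqP m0] /andP[_ /eqP m'0] e.
  apply/matrixP => i j; case: (unliftP ord0 i) => [i' ->|->].
    by have /matrixP/(_ i' j) := e; rewrite !mxE.
  have /matrixP/(_ 0 j) := m0; have /matrixP/(_ 0 j) := m'0.
  by rewrite !mxE => -> ->.
apply/subset_leq_card/fintype.subsetP => _ /imsetP[m + ->]; rewrite !inE => /andP[m0 /eqP r0].
apply: contra_neq m0 => e; apply/matrixP => i j.
case: (unliftP ord0 i) => [i' ->|->].
  by have /matrixP/(_ i' j) := e; rewrite !mxE.
by have /matrixP/(_ 0 j) := r0; rewrite !mxE.
Qed.

Section UpperBound.
Variables (N : zmodType) (phi : {additive N -> N}) (phi_bij : bijective phi).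
Local Notation G := (sdprodZ phi_bij).
Hypothesis fgN : finitely_generated_zmod N.
Variables (d : nat) (u : 'I_d.+1 -> N) (M m : nat) (A B chi : {poly int}).
Hypothesis gen : forall v, exists P, v *+ M = \sum_j zact phi (P j) (u j).
Hypothesis Au0 : zact phi A (u ord0) *+ m = 0.
Hypothesis chi_monic : chi \is monic.
Hypothesis chi0 : forall v, zact phi chi v = 0.
Hypothesis radB : exists j r, B ^+ j = A * r.
Variables (p k : nat).
Hypotheses (p_pr : prime p) (pM : ~~ (p %| M)%N) (pm : ~~ (p %| m)%N).
Hypothesis Bp0 : map_poly intr B != 0 :> {poly 'F_p}.
Local Notation n := (p ^ k.+1)%N.
Local Notation mat := 'M['F_p]_(d.+1, k.+1).
Local Notation vec := 'cV['F_p]_k.+1.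

(** Data attached to a maximal subgroup [H] of index [n] that does not contain
    [N]: the coordinates on the quotient of [N] by [H :&: N], the action of
    [phi] there, and a point of [H] above the generator of [Z]. *)
Definition max_data := ({additive N -> 'rV['F_p]_k.+1} * 'M['F_p]_k.+1 * N)%type.

Definition max_data_of (H : set G) (D : max_data) : Prop :=
  simple_quotient phi (fun v => H (v, 0)) D.1.1 D.1.2 /\ H (D.2, 1).

Lemma max_data_exists (H : set G) : is_maximal_subgroup H ->
  has_index H n -> ~ (forall v, H (v, 0)) -> exists D, max_data_of H D.
Proof.
move=> maxH Hn HN; have [p' [k' [q [Q [p'_pr nE qQ]]]]] :=
  maximal_simple_quotient fgN maxH HN Hn.
have pp' : p = p'.
  apply/eqP; rewrite -(dvdn_prime2 p_pr p'_pr).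
  have : (p %| p' ^ k'.+1)%N by rewrite -nE dvdn_exp.
  by rewrite Euclid_dvdX // => /andP[].
subst p'; have kk' : k = k'.
  by have /eqP := nE; rewrite eqn_exp2l ?prime_gt1 // => /eqP[].
subst k'; have [v Hv] := maximal_surj (let: And3 h _ _ := maxH in h) maxH HN 1.
by exists (q, Q, v).
Qed.

(** The code of a pair [(H, b)] determines it: [b] gives a functional on [N],
    known by its values on the [phi^i (u j)] and the polynomial by which it is
    killed, and this functional determines [H :&: N]. *)
Definition code (D : max_data) (b : vec) : 'rV['F_p]_k.+2 * mat * vec :=
  (poly_rV (char_poly D.1.2),
   \matrix_(j, i) (D.1.1 (iter i phi (u j)) *m b) 0 0,
   \col_i (D.1.1 (iter i phi D.2) *m b) 0 0).

Lemma code_inj H H' D D' b b' : is_subgroup H -> is_subgroup H' ->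
  max_data_of H D -> max_data_of H' D' -> b != 0 ->
  code D b = code D' b' -> H = H' /\ forall v, D.1.1 v *m b = D'.1.1 v *m b'.
Proof.
case: D D' => [[q Q] w] [[q' Q'] w'] sgH sgH' [/= qQ Hw] [/= qQ' Hw'] b0.
have szf (R : 'M['F_p]_k.+1) : (size (char_poly R) <= k.+2)%N by rewrite size_char_poly.
move=> eqc; have eqf' := congr1 (fun c => c.1.1) eqc.
have eqm := congr1 (fun c => c.1.2) eqc; have eqw := congr1 snd eqc.
have eqf : char_poly Q = char_poly Q'.
  by rewrite -(poly_rV_K (szf Q)) [poly_rV _]eqf' poly_rV_K.
have entry (x y : 'M['F_p]_1) : x 0 0 = y 0 0 -> x = y.
  by move=> e; apply/matrixP => i j; rewrite !ord1.
have eqv : forall v, q v *m b = q' v *m b'.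
  apply: (simple_quotient_functional_inj p_pr pM gen qQ qQ' eqf) => j i.
  have /matrixP/(_ j i) := eqm; rewrite !mxE => e.
  rewrite -(simple_quotient_iter _ _ qQ) -(simple_quotient_iter _ _ qQ').
  by apply: entry; rewrite !mxE.
have b'0 : b' != 0.
  apply: contra_neq b0 => b'0; apply/matrixP => i j.
  have [qsurj _ _ _] := qQ; have [v vE] := qsurj (delta_mx 0 i).
  by have /matrixP/(_ 0 j) := eqv v; rewrite vE b'0 mulmx0 -rowE !mxE.
split; last exact: eqv.
apply: (subgroup_eq_from_fibers sgH sgH' _ Hw Hw').
  move=> v; rewrite (simple_quotient_kernel _ qQ b0) (simple_quotient_kernel _ qQ' b'0).
  by split=> h i; have := h i; rewrite eqv.
rewrite (simple_quotient_kernel _ qQ b0) => i; apply: entry.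
have iterB : iter i phi (w - w') = iter i phi w - iter i phi w'.
  by rewrite -!zactXn raddfB.
rewrite iterB raddfB mulmxBl [RHS]mxE [LHS]mxE.
have /matrixP/(_ i 0) := eqw; rewrite mxE [RHS]mxE => ->.
by rewrite [X in _ + X]mxE eqv subrr.
Qed.

Lemma char_poly_irreducible_rows L (q : {additive N -> 'rV_k.+1}) Q (P : {poly 'F_p}) :
  simple_quotient phi L q Q -> char_poly Q %| P ->
  poly_rV (char_poly Q) \in irreducible_rows k P.
Proof.
move=> [_ _ _ irrQ] fP.
have szf : (size (char_poly Q) <= k.+2)%N by rewrite size_char_poly.
rewrite inE poly_rV_K // char_poly_monic size_char_poly eqxx fP !andbT.
exact/asboolP/irreducible_char_poly.
Qed.

Lemma char_poly_dvd_annihilator L (q : {additive N -> 'rV['F_p]_k.+1}) Q :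
  simple_quotient phi L q Q -> char_poly Q %| map_poly intr chi.
Proof.
move=> qQ; have [qsurj _ _ irrQ] := qQ; apply: contraT.
move=> /(horner_mx_coprime_unit irrQ); rewrite unitmxE.
suff -> : horner_mx Q (map_poly intr chi) = 0 by rewrite det0 unitr0.
apply/row_matrixP => i; have [v vE] := qsurj (delta_mx 0 i).
by rewrite rowE -vE -(simple_quotient_zact _ _ qQ) chi0 raddf0 row0.
Qed.

Lemma max_data_bound H D : max_data_of H D -> (k.+1 <= (size chi).-1)%N.
Proof.
move=> [/char_poly_dvd_annihilator/dvdp_leq + _]; rewrite size_char_poly.
have chip : (map_poly intr chi : {poly 'F_p}) \is monic by rewrite monic_map.
move=> /(_ (monic_neq0 chip)) le; rewrite -ltnS; apply: leq_trans le _.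
apply: leq_trans (size_poly _ _) _; rewrite prednK // size_poly_gt0.
exact: monic_neq0.
Qed.

(** The two parts of the union correspond to the characteristic polynomial of
    [Q] dividing [A], or not; in the second case the quotient kills
    [u ord0]. *)
Lemma code_in H D b : max_data_of H D -> b != 0 ->
  code D b \in finset.setX
    (finset.setX (irreducible_rows k (map_poly intr B)) [set x : mat | x != 0] :|:
     finset.setX (irreducible_rows k (map_poly intr chi))
       [set x : mat | (x != 0) && (row 0 x == 0)])%SET [set: vec]%SET.
Proof.
case: D => [[q Q] w] [/= qQ Hw] b0; have [qsurj _ _ irrQ] := qQ.
have matE j (i : 'I_k.+1) : q (iter i phi (u j)) *m b = q (u j) *m Q ^+ i *m b.
  by rewrite (simple_quotient_iter _ _ qQ).
have codeE j (i : 'I_k.+1) : (code (q, Q, w) b).1.2 j i = (q (u j) *m Q ^+ i *m b) 0 0.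
  by rewrite -matE mxE.
have code0 : (code (q, Q, w) b).1.2 != 0.
  apply: contra_neq b0 => c0; apply/matrixP => i j.
  have [v vE] := qsurj (delta_mx 0 i).
  suff : q v *m b = q v *m 0.
    by rewrite vE mulmx0 -rowE => /matrixP/(_ 0 j); rewrite !mxE.
  apply: (simple_quotient_functional_inj p_pr pM gen qQ qQ erefl) => j' i'.
  rewrite mulmx0; apply/matrixP => x y; rewrite !ord1 -codeE c0.
  by rewrite !mxE.
rewrite finset.in_setX inE [_ \in [set: _]%SET]inE andbT !finset.in_setX; apply/orP.
have [fA|nfA] := boolP (char_poly Q %| map_poly intr A); [left|right].
  rewrite [X in _ && X]inE code0 andbT; apply: (char_poly_irreducible_rows qQ).
  have [e [r Be]] := radB; apply: (@irreducible_dvdp_exp _ _ _ e).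
    exact: irreducible_char_poly.
  by rewrite -rmorphXn /= Be rmorphM dvdp_mulr.
apply/andP; split.
  apply: (char_poly_irreducible_rows qQ); exact: char_poly_dvd_annihilator qQ.
rewrite inE code0; apply/eqP/matrixP => x i; rewrite mxE codeE.
by rewrite (simple_quotient_torsion p_pr pm qQ Au0 nfA) !mul0mx !mxE.
Qed.

(** The factor [n.-1] counts the nonzero [b] for each subgroup, and the factor
    [n] the values of the functional at the point above the generator of [Z]. *)
Lemma maximal_count (s : seq (set G)) : uniq s ->
  (forall H, H \in s ->
     [/\ is_maximal_subgroup H, has_index H n & ~ (forall v, H (v, 0))]) ->
  (size s * n.-1 <=
    ((size B).-1 * (n ^ d.+1).-1 + (size chi).-1 * (n ^ d).-1) * n)%N.
Proof.
move=> us sP.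
have sI (i : 'I_(size s)) : nth setT s i \in s by rewrite mem_nth.
have /fin_all_exists[D DP] : forall i : 'I_(size s), exists D, max_data_of (nth setT s i) D.
  by move=> i; have [maxH Hn HN] := sP _ (sI i); exact: max_data_exists.
pose dom := finset.setX [set: 'I_(size s)]%SET [set b : vec | b != 0]%SET.
pose c (x : 'I_(size s) * vec) := code (D x.1) x.2.
have c_inj : {in dom &, injective c}.
  move=> [i b] [i' b']; rewrite !finset.in_setX !inE /= => b0 b'0 eqc.
  have [[sgH _ _] _ _] := sP _ (sI i); have [[sgH' _ _] _ _] := sP _ (sI i').
  have [eqH eqb] := code_inj sgH sgH' (DP i) (DP i') b0 eqc.
  have ii' : i = i'.
    by apply/val_inj/eqP; rewrite -(nth_uniq setT (ltn_ord i) (ltn_ord i') us) eqH.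
  subst i'; congr (_, _); apply/matrixP => j x.
  have [[qsurj _ _ _] _] := DP i; have [v vE] := qsurj (delta_mx 0 j).
  by have /matrixP/(_ 0 x) := eqb v; rewrite vE -!rowE !mxE.
have cardn (a : nat) : (p ^ (a * k.+1) = n ^ a)%N by rewrite mulnC expnM.
have -> : (size s * n.-1)%N = #|dom|.
  by rewrite cardsX cardsT card_ord card_nonzero card_mx card_Fp // muln1.
rewrite -(card_in_imset c_inj).
apply: (leq_trans (subset_leq_card (_ : c @: dom \subset _))).
  apply/fintype.subsetP => _ /imsetP[[i b] + ->]; rewrite !inE /= => b0.
  exact: code_in (DP i) b0.
rewrite cardsX cardsT card_mx card_Fp // muln1 leq_mul2r; apply/orP; right.
apply: leq_trans (leq_card_setU _ _) _; rewrite !cardsX.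
apply: leq_add; apply: leq_mul.
- apply: leq_trans (card_irreducible_rows _ Bp0) _.
  by rewrite -!subn1 leq_sub2r // size_poly.
- by rewrite card_nonzero card_mx card_Fp // cardn.
- have chip : (map_poly intr chi : {poly 'F_p}) \is monic by rewrite monic_map.
  apply: leq_trans (card_irreducible_rows _ (monic_neq0 chip)) _.
  by rewrite -!subn1 leq_sub2r // size_poly.
by have := @card_nonzero_row0 'F_p d k.+1; rewrite card_Fp // cardn.
Qed.

End UpperBound.

Section Counting.
Variables (R : realType) (T : choiceType) (X : set T).
Local Open Scope ereal_scope.

Lemma counting_le (b : nat) :
  (forall s : seq T, uniq s -> (forall x, x \in s -> X x) -> (size s <= b)%N) ->
  counting X <= (b%:R : R)%:E.
Proof.
move=> Xb; rewrite /counting; case: asboolP => [finX|/infinite_set_fset].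
  rewrite lee_fin ler_nat Xb ?finmap.fset_uniq // => x.
  by rewrite in_fset_set // inE.
move=> /(_ b.+1)[A AX]; rewrite ltnNge => /negP[].
by apply: Xb; [exact: finmap.fset_uniq|exact: AX].
Qed.

Lemma counting_ge (s : seq T) : uniq s -> (forall x, x \in s -> X x) ->
  ((size s)%:R : R)%:E <= counting X.
Proof.
move=> us sX; rewrite /counting; case: asboolP => [finX|_]; last exact: leey.
rewrite lee_fin ler_nat uniq_leq_size // => x /sX Xx.
by rewrite in_fset_set // inE.
Qed.

End Counting.

Section OverBase.
Variables (N : zmodType) (phi : {additive N -> N}) (phi_bij : bijective phi).
Local Notation G := (sdprodZ phi_bij).

(** A subgroup that contains [N] is the preimage of a subgroup [gZ] of [Z], and
    [g] is its index; so it is determined by its index. *)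
Lemma subgroup_over_base (H : set G) n : is_subgroup H -> (forall v, H (v, 0)) ->
  has_index H n -> forall v m, H (v, m) <-> (n%:Z %| m)%Z.
Proof.
move=> sgH HN Hn.
have base v m : H (v, m) <-> H (0, m).
  by split=> h; apply/(sub_fiber sgH _ h); exact: HN.
have HD m k : H (0, m) -> H (0, k) -> H (0, m + k).
  by move=> Hm Hk; apply/(base _ _).1/(subM sgH Hm Hk).
have HV m : H (0, m) -> H (0, - m) by move=> /(subV sgH)/base.
have [||i [j [lt cij]]] := @infinite_pigeonhole _ (left_cosets H)
    (fun i => [set (((0, i%:Z) : G) * h)%g | h in H]%classic).
- by apply/finite_setP; exists n.
- by move=> i; exists (0, i%:Z).
have exg : exists g, (0 < g)%N && `[< H (0, g%:Z) >].
  exists (j - i)%N; rewrite subn_gt0 lt /=; apply/asboolP.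
  have : [set (((0, j%:Z) : G) * h)%g | h in H]%classic (0, j%:Z).
    by exists 1%g; [case: sgH|rewrite mulg1].
  rewrite -cij => -[[w l] /base Hl [_ e]].
  by rewrite -subzn 1?ltnW // -e addrC addKr.
have [g /andP[g0 /asboolP Hg] gmin] := ex_minnP exg.
have Hmul (t : int) : H (0, t * g%:Z).
  have Hnat (l : nat) : H (0, l%:Z * g%:Z).
    elim: l => [|l IH]; first by rewrite mul0r; case: sgH.
    by rewrite -addn1 PoszD mulrDl mul1r; exact: HD.
  by case: t => l //; rewrite NegzE mulNr; exact: HV.
have HgP m : H (0, m) <-> (g%:Z %| m)%Z.
  split=> [Hm|/dvdzP[t ->]//].
  have Hr : H (0, (m %% g%:Z)%Z).
    by rewrite /modz -mulNr; apply: HD => //; exact: Hmul.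
  have r0 : (0 <= (m %% g)%Z) by rewrite modz_ge0 //; lia.
  have rg : ((m %% g)%Z < g%:Z) by rewrite ltz_pmod.
  rewrite (sameP dvdz_mod0P eqP); move: Hr r0 rg; case: (m %% g)%Z => [[|r]|] // Hr _.
  by rewrite ltz_nat ltnNge gmin //; apply/asboolP.
have gn : has_index H g.
  have gord (m : int) : (`|(m %% g)%Z| < g)%N.
    have r0 : (0 <= (m %% g)%Z) by rewrite modz_ge0 //; lia.
    have rg : ((m %% g)%Z < g%:Z) by rewrite ltz_pmod.
    by move: r0 rg; case: (m %% g)%Z.
  rewrite -(card_ord g).
  apply: (@has_index_card _ _ _ (fun x : G => Ordinal (gord x.2))) => [i'|[v m] [v' m']].
    exists (0, (i' : nat)%:Z); apply/val_inj => /=.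
    by rewrite modz_small //= ltz_nat.
  rewrite -[(_ * _)%g]/(- phi_pow phi_bij (- m) v + phi_pow phi_bij (- m) v', - m + m').
  rewrite base HgP addrC -eqz_mod_dvd.
  split=> [[e]|/eqP e].
    apply/eqP; move: (modz_ge0 m (d := g)) (modz_ge0 m' (d := g)) e.
    by case: (m %% g)%Z => ?; case: (m' %% g)%Z => ? //=; lia.
  by apply/val_inj; rewrite /= e.
by move=> v m; rewrite base HgP (has_index_inj Hn gn).
Qed.

End OverBase.

(** Here [n * (y - 1) <= (n - 1) * (2 * y)] and
    [n * (n * y - 1) <= (n - 1) * (n * y + 2 * y)] with [y = n ^ d]. *)
Lemma count_arith (n d x rho K : nat) : (1 < n)%N ->
  (x * n.-1 <= (rho * (n ^ d.+1).-1 + K * (n ^ d).-1) * n)%N ->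
  (x <= rho * n ^ d.+1 + (2 * rho + 2 * K) * n ^ d)%N.
Proof.
move=> n1 le; have y0 : (0 < n ^ d)%N by rewrite expn_gt0; lia.
rewrite -(leq_pmul2r (m := n.-1)); last by lia.
apply: leq_trans le _; move: y0; rewrite expnS; move: (n ^ d)%N => y y0.
have h1 : ((n * y).-1 * n <= (n * y + 2 * y) * n.-1)%N.
  by case: n n1 => [|[|z]] // _; case: y y0 => [|y] // _; rewrite -!subn1; nia.
have h2 : (y.-1 * n <= 2 * y * n.-1)%N.
  by case: n n1 {h1} => [|[|z]] // _; case: y y0 => [|y] // _; rewrite -!subn1; nia.
have -> : ((rho * (n * y) + (2 * rho + 2 * K) * y) * n.-1 =
    rho * ((n * y + 2 * y) * n.-1) + K * (2 * y * n.-1))%N by ring.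
rewrite mulnDl -(mulnA rho) -(mulnA K).
by apply: leq_add; apply: leq_mul.
Qed.

(** The bound [n0] excludes the small primes: if there is a maximal subgroup of
    index [n = p ^ k.+1] that does not contain [N] then [k.+1] is at most the
    degree [K] of [chi], so [n > n0] makes [p] larger than [M] and [m]. *)
Lemma nb_maximal_subgroups_upper (R : realType) (N : zmodType)
    (phi : {additive N -> N}) (phi_bij : bijective phi) (d : nat)
    (u : 'I_d.+1 -> N) (M m : nat) (A B : {poly int}) :
  finitely_generated_zmod N -> (0 < M)%N -> (0 < m)%N ->
  (forall v, exists P, v *+ M = \sum_j zact phi (P j) (u j)) ->
  zact phi A (u ord0) *+ m = 0 ->
  (exists j r, B ^+ j = A * r) ->
  (forall p, prime p -> map_poly intr B != 0 :> {poly 'F_p}) ->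
  exists C n0 : nat, forall n, (n0 < n)%N ->
    (nb_maximal_subgroups (sdprodZ phi_bij) R n <=
      (((size B).-1 * n ^ d.+1 + C * n ^ d)%N%:R)%:E)%E.
Proof.
move=> fgN M0 m0 gen Au0 radB Bp0.
have [chi chi_monic chi0] := integral_annihilator phi fgN.
pose K := (size chi).-1.
exists (2 * (size B).-1 + 2 * K + 1)%N, ((M + m + 1) ^ K)%N; move=> n n0n.
apply: counting_le => s us sX.
pose over (H : set (sdprodZ phi_bij)) := `[< forall v, H (v, 0) >].
rewrite -(count_predC over) -!size_filter.
set s1 := seq.filter over s; set s2 := seq.filter _ s.
have n_gt0 : (0 < n)%N by lia.
have nd : (0 < n ^ d)%N by rewrite expn_gt0 n_gt0.
have s1le : (size s1 <= 1)%N.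
  have us1 : uniq s1 by rewrite filter_uniq.
  suff : forall H H', H \in s1 -> H' \in s1 -> H = H'.
    move=> s1eq; case: (s1) us1 s1eq => [|H [|H' t]] //= /and3P[]; rewrite inE.
    move=> /norP[/eqP HH' _] _ _ /(_ H H'); rewrite !inE !eqxx orbT => e.
    by case: HH'; exact: e.
  move=> H H'; rewrite !mem_filter => /andP[/asboolP HN /sX[maxH Hn]].
  move=> /andP[/asboolP H'N /sX[maxH' H'n]].
  have [sgH _ _] := maxH; have [sgH' _ _] := maxH'.
  apply/seteqP; split=> -[v k].
    by move=> /(subgroup_over_base sgH HN Hn)/(subgroup_over_base sgH' H'N H'n).
  by move=> /(subgroup_over_base sgH' H'N H'n)/(subgroup_over_base sgH HN Hn).
have s2P H : H \in s2 ->
    [/\ is_maximal_subgroup H, has_index H n & ~ (forall v, H (v, 0))].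
  by rewrite mem_filter => /andP[/asboolPn HN /sX[]].
suff s2le : (size s2 <= (size B).-1 * n ^ d.+1 + (2 * (size B).-1 + 2 * K) * n ^ d)%N.
  apply: leq_trans (leq_add s1le s2le) _; rewrite (mulnDl (2 * _ + _)) mul1n addnC -addnA.
  by rewrite leq_add2l leq_add2l.
case s2E : s2 => [//|H t].
have [maxH Hn HN] : [/\ is_maximal_subgroup H, has_index H n & ~ (forall v, H (v, 0))].
  by apply: s2P; rewrite s2E mem_head.
have [p [k [q [Q [p_pr nE qQ]]]]] := maximal_simple_quotient fgN maxH HN Hn.
have us2 : uniq s2 by rewrite filter_uniq.
rewrite -s2E; subst n.
have [D DP] := max_data_exists fgN p_pr maxH Hn HN.
have kK := max_data_bound chi_monic chi0 DP.
have plarge : (M + m < p)%N.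
  rewrite ltnNge; apply/negP => le; move: n0n; rewrite ltnNge => /negP; apply.
  apply: (@leq_trans ((M + m + 1) ^ k.+1)); last by rewrite leq_pexp2l //; lia.
  by rewrite leq_exp2r //; lia.
have npd x : (0 < x)%N -> (x < p)%N -> ~~ (p %| x)%N.
  by move=> x0 xp; apply/negP => /(dvdn_leq x0); lia.
apply: count_arith; first by rewrite -[1%N](exp1n k.+1) ltn_exp2r // prime_gt1.
apply: (maximal_count fgN gen Au0 chi_monic chi0 radB p_pr) => //.
- by apply: npd; lia.
- by apply: npd; lia.
- exact: Bp0.
Qed.

(** * Lower bound *)

Section EigenFunctional.
Variables (N : zmodType) (phi : {additive N -> N}) (I : finType) (u : I -> N).
Variables (M p : nat) (l : 'F_p).
Hypotheses (p_pr : prime p) (pM : ~~ (p %| M)%N).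
Hypothesis gen : forall v, exists P, v *+ M = \sum_j zact phi (P j) (u j).
Hypothesis rel : forall P, \sum_j zact phi (P j) (u j) = 0 ->
  forall j, root (map_poly intr (P j)) l.

Local Notation ev P := ((map_poly intr P).[l]).

(** If [v *+ M] is the combination of the [u j] with coefficients [P j] then [h v]
    has to be the sum of the [c j * (P j).[l]] divided by [M].  This does not
    depend on the choice of the [P j], because the coefficients of a relation
    vanish at [l]. *)
Lemma eigen_functional_exists (c : I -> 'F_p) :
  exists h : {additive N -> 'F_p},
    (forall v, h (phi v) = l * h v) /\ forall j, h (u j) = c j.
Proof.
have M0 : M%:R != 0 :> 'F_p by rewrite pmulrn intr_Fp_eq0.
have /choice[P PE] := gen.
pose h v := M%:R^-1 * \sum_j c j * ev (P v j).
have hE v P' : v *+ M = \sum_j zact phi (P' j) (u j) ->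
    h v = M%:R^-1 * \sum_j c j * ev (P' j).
  move=> vE; congr (_ * _); apply: eq_bigr => j _; congr (_ * _).
  have : \sum_j zact phi (P v j - P' j) (u j) = 0.
    transitivity (v *+ M - v *+ M); last by rewrite subrr.
    rewrite {1}PE vE -sumrB; apply: eq_bigr => i _.
    by rewrite zactDl -mulN1r -polyCN zactCM mulrN1z.
  move=> /rel/(_ j); rewrite rmorphB rootE hornerD hornerN subr_eq0.
  by move/eqP.
have hD : zmod_morphism h.
  move=> v w; rewrite (hE _ (fun j => P v j - P w j)).
    rewrite /h -mulrBr -sumrB; congr (_ * _); apply: eq_bigr => j _.
    by rewrite rmorphB hornerD hornerN mulrBr.
  rewrite mulrnBl !PE -sumrB; apply: eq_bigr => i _.
  by rewrite zactDl -mulN1r -polyCN zactCM mulrN1z.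
pose hA := GRing.isZmodMorphism.Build _ _ h hD.
pose hadd : {additive N -> 'F_p} := HB.pack h hA.
exists hadd; split=> [v|j].
  rewrite -[hadd _]/(h _) -[hadd v]/(h v) (hE _ (fun j => 'X * P v j)).
    rewrite /h [RHS]mulrCA; congr (_ * _); rewrite mulr_sumr; apply: eq_bigr => j _.
    by rewrite rmorphM /= map_polyX hornerM hornerX mulrCA.
  rewrite -raddfMn PE raddf_sum; apply: eq_bigr => j _.
  by rewrite zactA zactX.
rewrite -[hadd _]/(h _) (hE _ (fun i => if i == j then M%:Z%:P else 0)).
  rewrite (bigD1 j) //= eqxx big1 ?addr0 => [|i ij].
    by rewrite map_polyC hornerC /= -pmulrn mulrCA mulVf ?mulr1.
  by rewrite (negPf ij) rmorph0 horner0 mulr0.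
rewrite (bigD1 j) //= eqxx big1 ?addr0 => [|i ij]; first by rewrite zactC.
by rewrite (negPf ij) zact0l.
Qed.

End EigenFunctional.

Section AffineSubgroup.
Variables (N : zmodType) (phi : {additive N -> N}) (phi_bij : bijective phi).
Local Notation G := (sdprodZ phi_bij).
Local Notation pow := (phi_pow phi_bij).
Variables (p : nat) (l s : 'F_p) (h : {additive N -> 'F_p}) (u0 : N).
Hypotheses (p_pr : prime p) (hphi : forall v, h (phi v) = l * h v) (hu0 : h u0 = 1).

(** The image of 0 under the [m]-th power of [t |-> l * t + s], in closed form
    so that [m] can be negative. *)
Definition translation (m : int) : 'F_p :=
  if l == 1 then s *~ m else s * (l ^ m - 1) / (l - 1).

(** [G] acts on the affine line over [F_p]: [v] acts as the translation by
    [h v] and the generator of [Z] as [t |-> l * t + s]. Then [orbit0 x] is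
    the image of 0 under [x], and the subgroup is the stabiliser of 0. *)
Definition orbit0 (x : G) : 'F_p := h x.1 + translation x.2.

Definition affine_stab : set G := fun x => orbit0 x = 0.

(** [u0] is in the image of [phi]. *)
Lemma eigenvalue_neq0 : l != 0.
Proof.
have [w /eqP wu] := bij_surj phi_bij u0; apply/eqP => l0.
by have := hphi w; rewrite wu hu0 l0 mul0r => /eqP; rewrite oner_eq0.
Qed.

Lemma translation1 : translation 1 = s.
Proof.
rewrite /translation; case: eqP => [_|/eqP l1]; first by rewrite mulr1z.
by rewrite expr1z mulfK // subr_eq0.
Qed.

Lemma translationD m k : translation (m + k) = translation m + l ^ m * translation k.
Proof.
rewrite /translation; case: eqP => [->|/eqP l1]; first by rewrite exp1rz mul1r mulrzDr.
have l1' : l - 1 != 0 by rewrite subr_eq0.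
by rewrite expfzDr ?eigenvalue_neq0 //; field.
Qed.

Lemma eigen_phi_pow m v : h (pow m v) = l ^ m * h v.
Proof.
case: m => k.
  elim: k => [|k IH] /=; first by rewrite mul1r.
  by rewrite hphi IH mulrA -exprS.
rewrite -[l ^ Negz k]/(l ^+ k.+1)^-1 /phi_pow.
elim: k.+1 => [|i IH]; first by rewrite expr0 invr1 mul1r.
apply: (mulfI eigenvalue_neq0); rewrite -hphi iterS phi_invK IH.
by rewrite mulrA exprS invfM mulrA mulfV ?eigenvalue_neq0 // mul1r.
Qed.

Lemma orbit0M x y : orbit0 (x * y)%g = orbit0 x + l ^ x.2 * orbit0 y.
Proof.
rewrite /orbit0 -[(x * y)%g]/(x.1 + pow x.2 y.1, x.2 + y.2) /=.
by rewrite raddfD eigen_phi_pow translationD; ring.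
Qed.

Lemma orbit01 : orbit0 1%g = 0.
Proof.
by rewrite /orbit0 raddf0 add0r /translation; case: eqP; rewrite ?subrr ?mulr0 ?mul0r.
Qed.

Lemma orbit0_eq x y : orbit0 x = orbit0 y <-> affine_stab (x^-1 * y)%g.
Proof.
have lx : l ^ x.2 != 0 by rewrite expfz_neq0 // eigenvalue_neq0.
have -> : orbit0 y = orbit0 x + l ^ x.2 * orbit0 (x^-1 * y)%g.
  by rewrite -orbit0M mulgA mulgV mul1g.
rewrite /affine_stab; split=> [/eqP|->]; last by rewrite mulr0 addr0.
by rewrite addrC -subr_eq subrr eq_sym mulf_eq0 (negPf lx) => /eqP.
Qed.

Lemma orbit0_base (i : nat) : orbit0 (u0 *+ i, 0) = i%:R.
Proof.
rewrite /orbit0 raddfMn hu0 /translation.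
by case: eqP; rewrite ?subrr ?mulr0 ?mul0r ?addr0.
Qed.

Lemma affine_stab_subgroup : is_subgroup affine_stab.
Proof.
split; first exact: orbit01.
  by move=> x y; rewrite /affine_stab orbit0M => -> ->; rewrite mulr0 addr0.
by move=> x x0; rewrite -[x^-1%g]mulg1; apply/orbit0_eq; rewrite orbit01.
Qed.

Lemma affine_stab_index : has_index affine_stab p.
Proof.
rewrite -[X in has_index _ X](card_Fp p_pr).
apply: (@has_index_card _ _ _ orbit0); last exact: orbit0_eq.
by move=> t; exists (u0 *+ t, 0); rewrite orbit0_base Fp_natK.
Qed.

(** A larger subgroup moves 0 to some [t != 0], hence contains an element of [N]
    that acts as the translation by [t]; its powers move 0 everywhere. *)
Lemma affine_stab_maximal : is_maximal_subgroup affine_stab.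
Proof.
split; first exact: affine_stab_subgroup.
  move=> HT; have : affine_stab (u0 *+ (1%R : 'F_p), 0) by rewrite HT.
  by rewrite /affine_stab orbit0_base Fp_natK => /eqP; rewrite oner_eq0.
move=> K sgK HK; have [KH|] := pselect (K `<=` affine_stab)%classic.
  by left; apply/seteqP.
move=> nKH; right.
have [x Kx x0] : exists2 x, K x & orbit0 x != 0.
  apply: contrapT => nx; apply: nKH => x Kx.
  by apply/eqP; apply: contrapT => /negP x0; apply: nx; exists x.
have Kvalue y z : K y -> orbit0 y = orbit0 z -> K z.
  move=> Ky /orbit0_eq/HK yz; case: sgK => _ KM _.
  by have := KM _ _ Ky yz; rewrite mulgA mulgV mul1g.
have Kbase : K (u0 *+ (orbit0 x), 0) by apply: Kvalue Kx _; rewrite orbit0_base Fp_natK.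
apply/seteqP; split=> // y _.
apply: (Kvalue _ _ (sub0Mn sgK (orbit0 y / orbit0 x)%R Kbase)).
by rewrite -mulrnA orbit0_base natrM !Fp_natK // mulrCA mulfV ?mulr1.
Qed.

End AffineSubgroup.

(** Each parameter can be read from the elements of the stabiliser: those in [N]
    form the kernel of [h], which determines [h] since [h (u o) = 1]; the
    elements above the generator of [Z] give [s]. *)
Lemma affine_stab_inj (N : zmodType) (phi : {additive N -> N})
    (phi_bij : bijective phi) (p : nat) (I : finType) (u : I -> N) (o : I)
    (l l' s s' : 'F_p) (h h' : {additive N -> 'F_p}) :
  (forall v, h (phi v) = l * h v) -> (forall v, h' (phi v) = l' * h' v) ->
  h (u o) = 1 -> h' (u o) = 1 ->
  @affine_stab _ _ phi_bij _ l s h = @affine_stab _ _ phi_bij _ l' s' h' ->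
  [/\ l = l', s = s' & forall j, h (u j) = h' (u j)].
Proof.
move=> hphi h'phi ho h'o eqH.
have translation0 (t r : 'F_p) : translation t r 0 = 0.
  by rewrite /translation; case: eqP; rewrite ?subrr ?mulr0 ?mul0r.
have ker v : h v = 0 -> h' v = 0.
  move=> hv; have : @affine_stab _ _ phi_bij _ l s h (v, 0).
    by rewrite /affine_stab /orbit0 hv translation0 addr0.
  by rewrite eqH /affine_stab /orbit0 translation0 addr0.
have subE (g : {additive N -> 'F_p}) w (t : 'F_p) : g (u o) = 1 ->
    g (w - u o *+ t) = g w - t.
  by move=> go; rewrite raddfB raddfMn go Fp_natK.
have hh' v : h v = h' v.
  have := ker (v - u o *+ (h v)); rewrite !subE // subrr.
  by move=> /(_ erefl)/eqP; rewrite subr_eq0 eq_sym => /eqP.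
split=> //.
  by have := hphi (u o); rewrite hh' h'phi ho h'o !mulr1.
have : @affine_stab _ _ phi_bij _ l s h (0 - u o *+ s, 1).
  by rewrite /affine_stab /orbit0 subE // raddf0 add0r translation1 addNr.
rewrite eqH /affine_stab /orbit0 subE // raddf0 add0r translation1.
by move/eqP; rewrite addrC subr_eq0 eq_sym => /eqP.
Qed.

Lemma nb_maximal_subgroups_lower (R : realType) (N : zmodType)
    (phi : {additive N -> N}) (phi_bij : bijective phi) (d : nat)
    (u : 'I_d.+1 -> N) (M p : nat) (L : seq 'F_p) :
  prime p -> ~~ (p %| M)%N ->
  (forall v, exists P, v *+ M = \sum_j zact phi (P j) (u j)) ->
  uniq L ->
  (forall P, \sum_j zact phi (P j) (u j) = 0 ->
     forall j, all (root (map_poly intr (P j))) L) ->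
  (((size L * p ^ d.+1)%N%:R : R)%:E <= nb_maximal_subgroups (sdprodZ phi_bij) R p)%E.
Proof.
move=> p_pr pM gen uL rel.
pose X := ('I_(size L) * {ffun 'I_d -> 'F_p} * 'F_p)%type.
pose l (x : X) := nth 0 L x.1.1.
(* The value 1 at [u ord0] normalises the functional among its multiples. *)
pose c (x : X) j := if unlift ord0 j is Some i then x.1.2 i else 1.
have /fin_all_exists[h hP] : forall x : X, exists h : {additive N -> 'F_p},
    (forall v, h (phi v) = l x * h v) /\ forall j, h (u j) = c x j.
  move=> x; apply: (eigen_functional_exists p_pr pM gen) => P P0 j.
  by have /all_nthP := rel P P0 j; apply.
have ho x : h x (u ord0) = 1 by rewrite (hP x).2 /c unlift_none.
pose H (x : X) := @affine_stab _ _ phi_bij _ (l x) x.2 (h x).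
have Hinj : injective H.
  move=> x y /(affine_stab_inj (hP x).1 (hP y).1 (ho x) (ho y))[eql eqs eqc].
  case: x y eql eqs eqc => [[i f] s] [[i' f'] s'] /= eql -> eqc.
  have -> : i = i'.
    apply/val_inj/eqP; rewrite -(nth_uniq 0 (ltn_ord i) (ltn_ord i') uL).
    by rewrite -/(l (i, f, s)) eql.
  congr (_, _, _); apply/ffunP => j; have := eqc (lift ord0 j).
  by rewrite (hP _).2 (hP _).2 /c liftK.
have -> : (size L * p ^ d.+1)%N = size (map H (enum {: X})).
  rewrite size_map -cardE !card_prod card_ord card_ffun card_Fp // card_ord.
  by rewrite -mulnA -expnSr.
apply: counting_ge; first by rewrite map_inj_uniq // enum_uniq.
move=> _ /mapP[x _ ->]; split.
  exact: affine_stab_maximal (hP x).1 (ho x).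
exact: affine_stab_index (hP x).1 (ho x).
Qed.

(** * Asymptotics *)

Import numFieldNormedType.Exports.
Local Open Scope classical_set_scope.
Local Open Scope card_scope.
Local Open Scope ring_scope.

Lemma unbounded_infinite (S : set nat) :
  (forall n, exists2 m, (n < m)%N & S m) -> infinite_set S.
Proof.
move=> unb /finite_seqP[s sE]; have [m lt] := unb (\max_(i <- s) i)%N.
rewrite sE /= => ms; move: lt; rewrite ltnNge => /negP; apply.
exact: (@leq_bigmax_seq _ s xpredT id m ms isT).
Qed.

Lemma card_roots_neq0 (C : numFieldType) (a : {poly rat}) n :
  [set z : C | root (map_poly ratr a) z] #= `I_n -> a != 0.
Proof.
move=> card_a; apply/eqP => a0; apply: infinite_nat.
have fin : finite_set [set z : C | root (map_poly ratr a) z].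
  by apply/finite_setP; exists n.
have [|i [j [lt]]] := @infinite_pigeonhole _ _ (fun i : nat => i%:R : C) fin.
  by move=> i; rewrite /= a0 rmorph0 root0.
by move/eqP; rewrite eqr_nat => /eqP e; rewrite e ltnn in lt.
Qed.

Theorem theorem72 (R : realType) (N : zmodType)
    (phi : {additive N -> N}) (phi_bij : bijective phi)
    (d : nat) (d_gt0 : (0 < d)%N) (a : 'I_d -> {poly rat}) (rho1 : nat) :
  let a1 := a (Ordinal d_gt0) in
  let G := sdprodZ phi_bij in
  let m n := nb_maximal_subgroups G R n in
  finitely_generated_zmod N ->
  (forall i j : 'I_d, (i <= j)%N -> a i %| a j) ->
  a1 \isn't a GRing.unit ->
  lmod_iso (polymod (qtensor_map phi)) (dsum (fun j => cyclic_module (a j))) ->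
  [set z : R[i] | root (map_poly ratr a1) z] #= `I_rho1 ->
  (exists e : nat -> R,
      e =O_\oo (fun n : nat => n%:R ^+ d.-1 : R) /\
      \forall n \near \oo, (m n <= (rho1%:R * n%:R ^+ d + e n)%:E)%E) /\
  infinite_set [set n | ((rho1%:R * n%:R ^+ d)%:E <= m n)%E].
Proof.
case: d d_gt0 a => // d d_gt0 a a1 G m fgN div_a _ iso card_a1.
have [A [B [Aa1 Aprim [sepB szB Bp0] [r1 AB] radB]]] :=
  integral_radical (card_roots_neq0 card_a1) card_a1.
have a1E : a1 = a ord0 by congr (a _); apply: val_inj.
have [u [[M M0 gen] rel tors]] := rational_generators fgN iso.
have [|t t0 Au0] := tors ord0 A; first by rewrite -a1E (eqp_dvdr _ Aa1).
split.
  have [C [n0 upper]] :=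
    nb_maximal_subgroups_upper R phi_bij fgN M0 t0 gen Au0 radB Bp0.
  exists (fun n => C%:R * n%:R ^+ d); split.
    apply/eqOP; exists C%:R; split; first exact: num_real.
    move=> k /ltW Ck; apply: nearW => n /=.
    by rewrite normrM ler_wpM2r // normr_nat.
  exists n0.+1 => // n /= /upper; rewrite szB.
  by rewrite natrD !natrM !natrX.
apply: unbounded_infinite => n.
have [p [p_pr lt [L [uL szL rootL]]]] := primes_with_all_roots (n + M) sepB.
exists p; first by lia.
have pM : ~~ (p %| M)%N by apply/negP => /(dvdn_leq M0); lia.
have := nb_maximal_subgroups_lower R phi_bij p_pr pM gen uL.
rewrite szL szB /= natrM natrX; apply=> P P0 j.
apply/allP => l lL; have := rel P P0 j.
move=> /(dvdp_trans (div_a ord0 j (leq0n _))); rewrite -a1E -(eqp_dvdl _ Aa1).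
rewrite dvdp_rat_int => /dvdpP_int[r2 ->]; rewrite Aprim AB !rmorphM !rootM.
by rewrite (allP rootL).
Qed.
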